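(* Let $\mathbb{K}$ be a field with $\mathrm{char}\,\mathbb{K}\neq2$ which contains at least one (nonzero) element that is not a root of unity, or is algebraically closed. Let $A=\mathcal{O}(M_n(\mathbb{K}))=\mathbb{K}[X_{ij}\mid1\le i,j\le n]$ with the Poisson bracket described in the context. Let $0\le k\le n-1$ and let $\mathcal{P}_k$ be the determinantal ideal of $A$ generated by all $(k+1)\times(k+1)$ minors of the matrix $(X_{ij})$. Then the field of fractions $\mathrm{Frac}(A/\mathcal{P}_k)$ is Poisson isomorphic to a Poisson affine field $\mathbb{K}_{\boldsymbol\mu}(Y_1,\dots,Y_m)$, where $m\le n^2$ and $\boldsymbol\mu\in M_m(\mathbb{K})$ is a skew-symmetric matrix.
   Context: The Poisson bracket on $A$ is determined, for $(i,j)$ smaller than $(l,m)$ in the lexicographic order, by $$\{X_{lm},X_{ij}\}=\begin{cases}-X_{ij}X_{lm}&\text{if } l>i,\ m=j,\\-X_{ij}X_{lm}&\text{if } l=i,\ m>j,\\0&\text{if } l>i,\ m<j,\\-2X_{im}X_{lj}&\text{if } l>i,\ m>j.\end{cases}$$ The ideal $\mathcal{P}_k$ is a prime ideal and a Poisson ideal (that is, $\{a,u\}\in\mathcal{P}_k$ for all $a\in A$, $u\in\mathcal{P}_k$), so $A/\mathcal{P}_k$ is a Poisson algebra and a domain, and its bracket extends uniquely to its field of fractions. For skew-symmetric $\boldsymbol\mu=(\mu_{ij})$, $\mathbb{K}_{\boldsymbol\mu}(Y_1,\dots,Y_m)$ is $\mathbb{K}(Y_1,\dots,Y_m)$ with the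 bracket determined by $\{Y_i,Y_j\}=\mu_{ij}Y_iY_j$. *)

(* Defs.v *)
From HB Require Import structures.
From mathcomp Require Import all_boot all_order perm all_algebra.
From mathcomp Require Import mpoly.
From mathcomp Require Import boolp.
From mathcomp Require Import ring zify.

Set Implicit Arguments.
Unset Strict Implicit.
Unset Printing Implicit Defensive.

Import GRing.Theory.
Local Open Scope ring_scope.
Local Open Scope quotient_scope.

Section GeneratedIdeal.
Variable R : comNzRingType.
Implicit Type S : R -> Prop.

Definition ideal_gen S : {pred R} := fun p =>
  `[< exists2 s : seq (R * R),
        (forall c, c \in s -> S c.2) & p = \sum_(c <- s) c.1 * c.2 >].

Lemma ideal_gen_sub S p : S p -> p \in ideal_gen S.
Proof.
move=> Sp; apply/asboolP; exists [:: (1, p)]; last by rewrite big_seq1 mul1r.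
by move=> c; rewrite inE => /eqP->.
Qed.

Lemma ideal_gen0 S : 0 \in ideal_gen S.
Proof. by apply/asboolP; exists [::]; rewrite ?big_nil. Qed.

Lemma ideal_genMD S a u v :
  u \in ideal_gen S -> v \in ideal_gen S -> a * u + v \in ideal_gen S.
Proof.
move=> /asboolP[s Ss ->] /asboolP[t St ->]; apply/asboolP.
exists ([seq (a * c.1, c.2) | c <- s] ++ t).
  move=> c; rewrite mem_cat => /orP[/mapP[d ds ->]|]; [exact: Ss ds|exact: St].
rewrite big_cat big_map mulr_sumr /=; congr (_ + _).
by apply: eq_bigr => c _; rewrite /= mulrA.
Qed.

End GeneratedIdeal.

Section MatrixCoordinates.
Variables (K : fieldType) (n : nat).

(* The coordinate ring of n x n matrices is {mpoly K[n * n]}, the entry (i, j)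
   being numbered by mxvec_index i j. *)
Definition Xmat : 'M[{mpoly K[n * n]}]_n := \matrix_(i, j) 'X_(mxvec_index i j).

Definition is_minor (r : nat) (p : {mpoly K[n * n]}) : Prop :=
  exists f g : 'I_r -> 'I_n,
    [/\ {homo f : i j / (i < j)%N}, {homo g : i j / (i < j)%N}
      & p = \det (mxsub f g Xmat)].

Definition det_ideal (k : nat) : {pred {mpoly K[n * n]}} :=
  ideal_gen (is_minor k.+1).

Lemma det_ideal_closed k : idealr_closed (det_ideal k).
Proof.
split; [exact: ideal_gen0| |move=> a u v uP vP; exact: ideal_genMD].
apply/negP => /asboolP[s sP /(congr1 (meval (fun=> 0)))].
rewrite rmorph1 rmorph_sum big_seq big1 => [/eqP|c /sP[f [g [_ _ ->]]]].
  by rewrite oner_eq0.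
rewrite rmorphM -det_map_mx (_ : map_mx _ _ = 0) ?det0 ?mulr0 //.
apply/matrixP => i j; rewrite !mxE; exact: mevalXU.
Qed.

HB.instance Definition _ k :=
  isIdealr.Build {mpoly K[n * n]} (det_ideal k) (det_ideal_closed k).

End MatrixCoordinates.

Arguments det_ideal : clear implicits.

Section DetIdealTheory.
Variables (K : fieldType) (n : nat).
Local Notation X := (Xmat K n).

Lemma det_ideal0 k : 0 \in det_ideal K n k.
Proof. exact: ideal_gen0. Qed.

Lemma det_idealD k : {in det_ideal K n k &, forall u v, u + v \in det_ideal K n k}.
Proof. by move=> u v uP vP; rewrite -[u]mul1r; apply: ideal_genMD. Qed.

Lemma det_idealM k a u : u \in det_ideal K n k -> a * u \in det_ideal K n k.
Proof. by move=> uP; rewrite -[_ * _]addr0; apply: ideal_genMD; rewrite ?ideal_gen0. Qed.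

Lemma det_ideal_sum k (I : Type) (r : seq I) (P : pred I) F :
  (forall i, P i -> F i \in det_ideal K n k) ->
  \sum_(i <- r | P i) F i \in det_ideal K n k.
Proof.
by move=> FP; apply: (big_ind (fun u => u \in _) (det_ideal0 k) (@det_idealD k)).
Qed.

Lemma inj_sort r (f : 'I_r -> 'I_n) : injective f ->
  exists s : 'S_r, {homo f \o s : i j / (i < j)%N}.
Proof.
move=> fI; pose t := [tuple f i | i < r].
pose le (a b : 'I_n) := (a <= b)%N.
have /tuple_permP[s /= Es] : perm_eq (sort_tuple le t) t by rewrite perm_sort.
exists s => i j ij /=.
have nthE (a : 'I_r) : nth (f i) (sort le t) a = f (s a).
  by rewrite Es /= (nth_map a) ?size_enum_ord // nth_ord_enum tnth_mktuple.
have srt : sorted le (sort le t).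
  by apply: sort_sorted => a b; exact: leq_total.
have lt : transitive le.
  by move=> b a c; exact: leq_trans.
rewrite ltn_neqAle (inj_eq val_inj) (inj_eq fI) (inj_eq perm_inj).
rewrite -val_eqE neq_ltn ij /= -!nthE.
by apply: (sorted_ltn_nth lt) => //; rewrite inE size_sort size_tuple.
Qed.

Lemma det_ideal_mxsub k (f g : 'I_k.+1 -> 'I_n) :
  \det (mxsub f g X) \in det_ideal K n k.
Proof.
have [fI|fN] := pselect (injective f); last first.
  suff -> : \det (mxsub f g X) = 0 by exact: det_ideal0.
  have /injectivePn[a [b ab fab]] : ~~ injectiveb f by apply/negP => /injectiveP.
  by apply: (determinant_alternate ab) => j; rewrite !mxE fab.
have [gI|gN] := pselect (injective g); last first.
  suff -> : \det (mxsub f g X) = 0 by exact: det_ideal0.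
  have /injectivePn[a [b ab gab]] : ~~ injectiveb g by apply/negP => /injectiveP.
  by rewrite -det_tr; apply: (determinant_alternate ab) => j; rewrite !mxE gab.
have [s sP] := inj_sort fI; have [t tP] := inj_sort gI.
have -> : mxsub f g X =
    row_perm s^-1 (col_perm t^-1 (mxsub (f \o s) (g \o t) X)).
  by apply/matrixP => i j; rewrite !mxE /= !permKV.
rewrite row_permE col_permE !det_mulmx det_perm [\det (perm_mx _)]det_perm.
rewrite [X in _ * X]mulrC; do 2!apply: det_idealM.
by apply: ideal_gen_sub; exists (f \o s), (g \o t).
Qed.

End DetIdealTheory.

(* Primality of det_ideal. Modulo the minors every polynomial is a combination
   of monomials whose support contains no diagonal chain of k + 1 cells. Such a
   combination vanishing at Y * Z is zero: a heaviest monomial in it splits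
   into k antichains, and an antichain has the least weight among the multisets
   of cells with the same row and column contents, so nothing cancels the
   corresponding monomial in Y and Z. Hence det_ideal is the kernel of
   X |-> Y * Z. *)
Section Contents.
Local Open Scope nat_scope.
Implicit Types (S T : seq (nat * nat)) (x y : nat * nat).

Definition cell_weight x := x.1.+1 * x.2.+1.
Definition cell_lt x y := (x.1 < y.1) && (x.2 < y.2).
Definition seq_weight S := \sum_(x <- S) cell_weight x.
Definition corner S p q := count (fun x => (p <= x.1) && (q <= x.2)) S.

Lemma cell_weightE n x : x.1 < n -> x.2 < n ->
  cell_weight x = \sum_(p < n) \sum_(q < n) ((p <= x.1) && (q <= x.2)).
Proof.
move=> x1 x2; have E a : a < n -> a.+1 = \sum_(p < n) (p <= a).
  have -> : \sum_(p < n) (p <= a) = minn n a.+1; last by lia.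
  by elim: {x1 x2} n => [|m IH]; rewrite ?big_ord0 ?min0n // big_ord_recr /= IH; lia.
rewrite /cell_weight (E _ x1) big_distrl /=; apply: eq_bigr => p _.
by rewrite (E _ x2) big_distrr /=; apply: eq_bigr => q _; rewrite mulnb.
Qed.

Lemma seq_weightE n S : {in S, forall x, x.1 < n /\ x.2 < n} ->
  seq_weight S = \sum_(p < n) \sum_(q < n) corner S p q.
Proof.
move=> SP; rewrite /seq_weight (eq_big_seq (fun x => \sum_(p < n) \sum_(q < n) ((p <= x.1) && (q <= x.2)))); last first.
  by move=> x /SP[]; exact: cell_weightE.
rewrite exchange_big; apply: eq_bigr => p _.
rewrite exchange_big; apply: eq_bigr => q _.
by rewrite /corner -sum1_count [RHS]big_mkcond.
Qed.

Definition same_content S T :=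
  (forall P : pred nat, count (fun x => P x.1) S = count (fun x => P x.1) T) /\
  (forall P : pred nat, count (fun x => P x.2) S = count (fun x => P x.2) T).

Lemma count_split (S : seq (nat * nat)) (P Q : pred (nat * nat)) :
  count P S = count (fun x => P x && Q x) S + count (fun x => P x && ~~ Q x) S.
Proof. by elim: S => //= x S ->; case: (P x); case: (Q x) => /=; lia. Qed.

Lemma corner_antichain S T p q : same_content S T ->
  {in S &, forall x y, ~~ cell_lt x y} -> corner S p q <= corner T p q.
Proof.
move=> [R C] anti.
have r : count (fun x => p <= x.1) S = count (fun x => p <= x.1) T by apply: (R).
have c : count (fun x => ~~ (q <= x.2)) S = count (fun x => ~~ (q <= x.2)) T.
  exact: (C (fun a => ~~ (q <= a))).
rewrite (count_split S _ (fun x => q <= x.2)) in r.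
rewrite (count_split T _ (fun x => q <= x.2)) in r.
rewrite (count_split S _ (fun x => p <= x.1)) in c.
rewrite (count_split T _ (fun x => p <= x.1)) in c.
have cm U : count (fun x => ~~ (q <= x.2) && (p <= x.1)) U
    = count (fun x => (p <= x.1) && ~~ (q <= x.2)) U.
  by apply: eq_count => x; rewrite andbC.
rewrite !cm in c; rewrite /corner.
have [->//|] := posnP (count (fun x => (p <= x.1) && (q <= x.2)) S).
rewrite -has_count => /hasP[x xS /andP[px qx]].
suff E : count (fun x => ~~ (q <= x.2) && ~~ (p <= x.1)) S = 0 by lia.
apply/eqP; rewrite -leqn0 leqNgt -has_count; apply/hasP => -[y yS /andP[]].
rewrite -!ltnNge => yq yp; have := anti _ _ yS xS.
by rewrite /cell_lt (leq_trans yp) ?(leq_trans yq).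
Qed.

Lemma corner_chain S T p q : same_content S T ->
  {in S &, forall x y, x.1 < y.1 -> x.2 < y.2} -> corner T p q <= corner S p q.
Proof.
move=> [R C] chn.
have r : count (fun x => p <= x.1) S = count (fun x => p <= x.1) T by apply: (R).
have c : count (fun x => q <= x.2) S = count (fun x => q <= x.2) T by apply: (C).
rewrite (count_split S _ (fun x => q <= x.2)) in r.
rewrite (count_split T _ (fun x => q <= x.2)) in r.
rewrite (count_split S _ (fun x => p <= x.1)) in c.
rewrite (count_split T _ (fun x => p <= x.1)) in c.
have cm U : count (fun x => (q <= x.2) && (p <= x.1)) U
    = count (fun x => (p <= x.1) && (q <= x.2)) U.
  by apply: eq_count => x; rewrite andbC.
rewrite !cm in c; rewrite /corner.
have [E|] := posnP (count (fun x => (p <= x.1) && ~~ (q <= x.2)) S); first by lia.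
rewrite -has_count => /hasP[x xS /andP[px]]; rewrite -ltnNge => qx.
suff E : count (fun x => (q <= x.2) && ~~ (p <= x.1)) S = 0 by lia.
apply/eqP; rewrite -leqn0 leqNgt -has_count; apply/hasP => -[y yS /andP[yq]].
rewrite -ltnNge => yp.
have := chn _ _ yS xS (leq_trans yp px); lia.
Qed.

Lemma corner_inj S T : (forall p q, corner S p q = corner T p q) -> perm_eq S T.
Proof.
move=> E; apply/allP => -[i j] _ /=; apply/eqP.
have cE U : count_mem (i, j) U + corner U i.+1 j + corner U i j.+1 =
    corner U i j + corner U i.+1 j.+1.
  rewrite /corner; elim: U => //= -[a b] U /= IH; rewrite xpair_eqE.
  have H : ((a == i) && (b == j)) + ((i < a) && (j <= b)) + ((i <= a) && (j < b)) =
      ((i <= a) && (j <= b)) + ((i < a) && (j < b)).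
    by case: (ltngtP a i); case: (ltngtP b j).
  lia.
have hS := cE S; rewrite !E -(cE T) -!addnA in hS; exact: addIn hS.
Qed.

Lemma content_bound n S T : same_content S T ->
  {in T, forall x, x.1 < n /\ x.2 < n} -> {in S, forall x, x.1 < n /\ x.2 < n}.
Proof.
move=> [R C] TP x xS; rewrite !ltnNge; split; apply/negP => le.
  have : has (fun x => n <= x.1) S by apply/hasP; exists x.
  rewrite has_count (R (fun a => n <= a)) -has_count => /hasP[y /TP[]]; lia.
have : has (fun x => n <= x.2) S by apply/hasP; exists x.
rewrite has_count (C (fun a => n <= a)) -has_count => /hasP[y /TP[]]; lia.
Qed.

Lemma sum2_le_eq n (F G : nat -> nat -> nat) :
  (forall p q, F p q <= G p q) ->
  \sum_(p < n) \sum_(q < n) G p q <= \sum_(p < n) \sum_(q < n) F p q ->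
  forall p q, p < n -> q < n -> F p q = G p q.
Proof.
move=> FG le p q pn qn.
rewrite !pair_bigA /= in le.
have /leqif_sum := fun (i : 'I_n * 'I_n) (_ : true) => leqif_eq (FG i.1 i.2).
move=> -[_]; rewrite eqn_leq le andbT leq_sum; last by move=> i _; exact: FG.
by move=> /esym /forallP /(_ (Ordinal pn, Ordinal qn)) /eqP.
Qed.

Lemma weight_le_perm n S T :
  {in S, forall x, x.1 < n /\ x.2 < n} -> {in T, forall x, x.1 < n /\ x.2 < n} ->
  (forall p q, corner S p q <= corner T p q) ->
  seq_weight S <= seq_weight T /\ (seq_weight T <= seq_weight S -> perm_eq S T).
Proof.
move=> Sn Tn le; rewrite !(seq_weightE Sn, seq_weightE Tn); split.
  by apply: leq_sum => p _; apply: leq_sum => q _; exact: le.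
move=> ge; apply: corner_inj => p q.
have out U : {in U, forall x, x.1 < n /\ x.2 < n} -> ~~ ((p < n) && (q < n)) ->
    corner U p q = 0.
  move=> Un pq; apply/eqP; rewrite -leqn0 leqNgt -has_count.
  by apply/hasP => -[x /Un[]]; lia.
have [/andP[pn qn]|pq] := boolP ((p < n) && (q < n)); last by rewrite !out.
exact: sum2_le_eq le ge p q pn qn.
Qed.

Lemma antichain_weight n S T : same_content S T ->
  {in T, forall x, x.1 < n /\ x.2 < n} -> {in S &, forall x y, ~~ cell_lt x y} ->
  seq_weight S <= seq_weight T /\ (seq_weight T <= seq_weight S -> perm_eq S T).
Proof.
move=> ST Tn anti; apply: (@weight_le_perm n) => //; first exact: content_bound ST Tn.
by move=> p q; exact: corner_antichain.
Qed.

Lemma chain_weight n S T : same_content S T ->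
  {in T, forall x, x.1 < n /\ x.2 < n} ->
  {in S &, forall x y, x.1 < y.1 -> x.2 < y.2} ->
  seq_weight T <= seq_weight S /\ (seq_weight S <= seq_weight T -> perm_eq T S).
Proof.
move=> ST Tn chn; apply: (@weight_le_perm n) => //; first exact: content_bound ST Tn.
by move=> p q; exact: corner_chain.
Qed.

End Contents.

Lemma ord_homo_inj a b (f : 'I_a -> 'I_b) :
  {homo f : i j / (i < j)%N} -> injective f.
Proof.
move=> fh i j fij; apply: val_inj.
by case: (ltngtP i j) => // /fh; rewrite fij ltnn.
Qed.

Section Reduction.
Variables (K : fieldType) (n k : nat).
Local Notation A := {mpoly K[n * n]}.
Local Notation X := (Xmat K n).

Definition rowi (s : 'I_(n * n)) : 'I_n := mxvec (\matrix_(i, j) i) 0 s.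
Definition coli (s : 'I_(n * n)) : 'I_n := mxvec (\matrix_(i, j) j) 0 s.
Definition cell_of (s : 'I_(n * n)) : nat * nat := (rowi s : nat, coli s : nat).

Lemma rowiE i j : rowi (mxvec_index i j) = i.
Proof. by rewrite /rowi mxvecE mxE. Qed.

Lemma coliE i j : coli (mxvec_index i j) = j.
Proof. by rewrite /coli mxvecE mxE. Qed.

Lemma index_rowcol s : mxvec_index (rowi s) (coli s) = s.
Proof. by case/mxvec_indexP: s => i j; rewrite rowiE coliE. Qed.

Lemma cell_of_inj : injective cell_of.
Proof.
move=> s t [/val_inj r /val_inj c].
by rewrite -(index_rowcol s) -(index_rowcol t) r c.
Qed.

Lemma cell_of_lt s : ((cell_of s).1 < n)%N /\ ((cell_of s).2 < n)%N.
Proof. by split; exact: ltn_ord. Qed.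

Definition mnm_weight (m : 'X_{1..n * n}) : nat :=
  (\sum_i m i * cell_weight (cell_of i))%N.

Lemma mnm_weightD m m' : mnm_weight (m + m')%MM = (mnm_weight m + mnm_weight m')%N.
Proof.
by rewrite -big_split; apply: eq_bigr => i _ /=; rewrite mnmDE mulnDl.
Qed.

Lemma mnm_weight1 i : mnm_weight U_(i)%MM = cell_weight (cell_of i).
Proof.
rewrite /mnm_weight (bigD1 i) //= mnm1E eqxx mul1n big1 ?addn0 // => j /negPf ij.
by rewrite mnm1E eq_sym ij.
Qed.

Lemma mnm_weight_sum (I : Type) (r : seq I) (F : I -> 'I_(n * n)) :
  mnm_weight (\sum_(p <- r) U_(F p))%MM = seq_weight [seq cell_of (F p) | p <- r].
Proof.
rewrite /seq_weight big_map.
elim: r => [|p r IH]; last by rewrite !big_cons mnm_weightD mnm_weight1 IH.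
by rewrite !big_nil /mnm_weight big1 // => i _; rewrite mnm0E.
Qed.

Definition has_chain (m : 'X_{1..n * n}) : Prop :=
  exists f g : 'I_k.+1 -> 'I_n,
    [/\ {homo f : i j / (i < j)%N}, {homo g : i j / (i < j)%N}
      & forall i, (0 < m (mxvec_index (f i) (g i)))%N].

Definition reducible (p : A) : Prop :=
  exists2 f : A, p - f \in det_ideal K n k & forall m, has_chain m -> f@_m = 0.

Lemma reducible0 : reducible 0.
Proof. by exists 0; rewrite ?subr0 ?det_ideal0 // => m _; rewrite mcoeff0. Qed.

Lemma reducibleD p q : reducible p -> reducible q -> reducible (p + q).
Proof.
move=> [f pf fc] [g qg gc]; exists (f + g).
  by rewrite opprD addrACA; exact: det_idealD.
by move=> m mc; rewrite mcoeffD fc ?gc ?addr0.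
Qed.

Lemma reducibleZ c p : reducible p -> reducible (c *: p).
Proof.
move=> [f pf fc]; exists (c *: f).
  by rewrite -scalerBr -mul_mpolyC; exact: det_idealM.
by move=> m mc; rewrite mcoeffZ fc ?mulr0.
Qed.

Lemma mpolyX_sum N (I : Type) (r : seq I) (P : pred I) (F : I -> 'X_{1..N}) :
  'X_[\sum_(p <- r | P p) F p] = \prod_(p <- r | P p) 'X_[F p] :> {mpoly K[N]}.
Proof.
apply: (big_morph (fun m => 'X_[m] : {mpoly K[N]})); last exact: mpolyX0.
by move=> a b; exact: mpolyXD.
Qed.

Lemma reducible_mnm m : reducible 'X_[m].
Proof.
have [w] := ubnP (mnm_weight m); elim: w m => // w IH m /ltnSE le_w.
have [[f [g [fh gh mp]]]|nc] := pselect (has_chain m); last first.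
  exists 'X_[m]; first by rewrite subrr det_ideal0.
  by move=> m' hm; rewrite mcoeffX; case: eqP => // E; case: nc; rewrite E.
have [fI gI] := (ord_homo_inj fh, ord_homo_inj gh).
pose e (s : 'S_k.+1) := (\sum_i U_(mxvec_index (f i) (g (s i))))%MM : 'X_{1..n * n}.
pose m0 := (m - e 1%g)%MM.
have mE : m = (m0 + e 1%g)%MM.
  rewrite submK //; apply/mnm_lepP => x; rewrite mnm_sumE.
  have [[i <-]|nx] := pselect (exists i, mxvec_index (f i) (g i) = x).
    rewrite (bigD1 i) //= perm1 mnm1E eqxx big1 ?addn0 // => j ji.
    rewrite perm1 mnm1E; case: eqP => // /(congr1 rowi).
    by rewrite !rowiE => /fI E; rewrite E eqxx in ji.
  rewrite big1 // => i _; rewrite perm1 mnm1E; case: eqP => // E.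
  by case: nx; exists i.
have detE : \det (mxsub f g X) = \sum_(s : 'S_k.+1) (-1) ^+ s *: 'X_[e s].
  apply: eq_bigr => s _; rewrite mpolyX_sum -mul_mpolyC rmorphXn rmorphN rmorph1.
  by congr (_ * _); apply: eq_bigr => i _; rewrite !mxE.
have DP : 'X_[m0] * \det (mxsub f g X) \in det_ideal K n k.
  by apply: det_idealM; exact: det_ideal_mxsub.
have E : 'X_[m] = 'X_[m0] * \det (mxsub f g X) -
    \sum_(s : 'S_k.+1 | s != 1%g) (-1) ^+ s *: 'X_[m0 + e s].
  rewrite detE mulr_sumr (bigD1 (1%g : 'S_k.+1)) //= odd_perm1 expr0 scale1r.
  rewrite -mpolyXD -mE -addrA -sumrB big1 ?addr0 // => s _.
  by rewrite -scalerAr -mpolyXD subrr.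
rewrite E; apply: reducibleD.
  by exists 0; rewrite ?subr0 // => m' _; rewrite mcoeff0.
rewrite -scaleN1r; apply: reducibleZ; apply: big_ind => [|p q|s s1].
- exact: reducible0.
- exact: reducibleD.
apply: reducibleZ; apply: IH; apply: leq_trans le_w.
rewrite mE !mnm_weightD ltn_add2l !mnm_weight_sum.
set S := [seq cell_of (mxvec_index (f p) (g ((1%g : 'S_k.+1) p))) | p <- _].
set T := [seq cell_of (mxvec_index (f p) (g (s p))) | p <- _].
have cE t p : cell_of (mxvec_index (f p) (g (t p : 'I_k.+1))) = (f p : nat, g (t p) : nat).
  by rewrite /cell_of rowiE coliE.
have SE : S = [seq (f p : nat, g p : nat) | p <- index_enum 'I_k.+1].
  by apply: eq_map => p; rewrite cE perm1.
have TE : T = [seq (f p : nat, g (s p) : nat) | p <- index_enum 'I_k.+1].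
  by apply: eq_map => p; rewrite cE.
have ST : same_content S T.
  split=> P; rewrite SE TE !count_map //=.
  rewrite -!sum1_count /= (reindex_inj (@perm_inj _ s)) /=.
  by rewrite [LHS]big_mkcond [RHS]big_mkcond.
have Tn : {in T, forall x, (x.1 < n)%N /\ (x.2 < n)%N}.
  by move=> x /mapP[p _ ->]; exact: cell_of_lt.
have chn : {in S &, forall x y, (x.1 < y.1)%N -> (x.2 < y.2)%N}.
  rewrite SE => x y /mapP[p _ ->] /mapP[q _ ->] /= fpq.
  by case: (ltngtP p q) => [/gh//|/fh|/val_inj pq]; last rewrite pq ltnn // in fpq *; lia.
have [_ eq] := chain_weight ST Tn chn.
rewrite ltnNge; apply/negP => /eq TS; case/eqP: s1; apply/permP => p; rewrite perm1.
have : (f p : nat, g (s p) : nat) \in S.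
  by rewrite -(perm_mem TS) TE; apply/mapP; exists p; rewrite ?mem_index_enum.
by rewrite SE => /mapP[q _ [/val_inj /fI -> /val_inj /gI]].
Qed.

Lemma reducibleP p : reducible p.
Proof.
rewrite [p]mpolyE; apply: big_ind => [|a b|m _].
- exact: reducible0.
- exact: reducibleD.
exact/reducibleZ/reducible_mnm.
Qed.

End Reduction.

Section GenericRank.
Variables (K : fieldType) (n k : nat).
Local Notation A := {mpoly K[n * n]}.
Local Notation X := (Xmat K n).
Local Notation V := ('I_n * 'I_k + 'I_k * 'I_n)%type.
Local Notation B := {mpoly K[#|{: V}|]}.

Definition yz_mnm (s : 'I_(n * n)) (r : 'I_k) : 'X_{1..#|{: V}|} :=
  (U_(enum_rank (inl (rowi s, r) : V)) + U_(enum_rank (inr (r, coli s) : V)))%MM.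

(* X |-> Y * Z for generic matrices Y (n x k) and Z (k x n) *)
Definition yz_map : A -> B :=
  mmap (@mpolyC #|{: V}| K) (fun s => \sum_r 'X_[yz_mnm s r]).

HB.instance Definition _ := GRing.RMorphism.on yz_map.

Lemma yz_map_var s : yz_map 'X_s = \sum_r 'X_[yz_mnm s r].
Proof. by rewrite /yz_map mmapX mmap1U. Qed.

Lemma yz_map_minor (f g : 'I_k.+1 -> 'I_n) : yz_map (\det (mxsub f g X)) = 0.
Proof.
rewrite -det_map_mx.
pose Y : 'M[B]_(1 + k, k) := \matrix_(i, r) 'X_(enum_rank (inl (f i, r) : V)).
pose Z : 'M[B]_(k, 1 + k) := \matrix_(r, j) 'X_(enum_rank (inr (r, g j) : V)).
have -> : map_mx yz_map (mxsub f g X) =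
    row_mx (0 : 'M_(1 + k, 1)) Y *m col_mx (0 : 'M_(1, 1 + k)) Z.
  rewrite mul_row_col mul0mx add0r; apply/matrixP => i j; rewrite !mxE.
  rewrite yz_map_var; apply: eq_bigr => r _.
  by rewrite !mxE /yz_mnm rowiE coliE mpolyXD.
rewrite det_mulmx [X in X * _](_ : _ = 0) ?mul0r //.
rewrite (expand_det_col _ (lshift k (ord0 : 'I_1))) big1 // => i _.
by rewrite row_mxEl mxE mul0r.
Qed.

Lemma yz_map_ideal p : p \in det_ideal K n k -> yz_map p = 0.
Proof.
move=> /asboolP[s sP ->]; rewrite rmorph_sum big_seq big1 // => c /sP[f [g [_ _ E]]].
by rewrite rmorphM E /= yz_map_minor mulr0.
Qed.

Definition mnm_seq (m : 'X_{1..n * n}) : seq 'I_(n * n) :=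
  flatten [seq nseq (m i) i | i <- enum 'I_(n * n)].

Lemma mnm_seqE m : m = (\sum_(i <- mnm_seq m) U_(i))%MM.
Proof.
rewrite {1}[m]multinomUE_id /mnm_seq big_flatten big_map /= big_enum /=.
apply: eq_bigr => i _; rewrite big_nseq.
by elim: (m i) => [|a IH]; rewrite ?mulm0n //= mulmS IH.
Qed.

Lemma mnm_seq_mem m i : i \in mnm_seq m -> (0 < m i)%N.
Proof. by move=> /flattenP[_ /mapP[j _ ->]]; rewrite mem_nseq => /andP[mj /eqP ->]. Qed.

Lemma yz_coef d (s : 'I_d -> 'I_(n * n)) (t : 'X_{1..#|{: V}|}) :
  (yz_map 'X_[\sum_p U_(s p)])@_t =
  \sum_(c : {ffun 'I_d -> 'I_k}) ((\sum_p yz_mnm (s p) (c p))%MM == t)%:R.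
Proof.
rewrite mpolyX_sum rmorph_prod /=.
under eq_bigr do rewrite yz_map_var.
rewrite bigA_distr_bigA /= raddf_sum; apply: eq_bigr => c _ /=.
by rewrite -mpolyX_sum mcoeffX.
Qed.

Definition color_cells d (s : 'I_d -> 'I_(n * n)) (c : 'I_d -> 'I_k) (r : 'I_k) :=
  [seq cell_of (s p) | p <- enum 'I_d & c p == r].

Lemma color_row d (s : 'I_d -> 'I_(n * n)) c r (P : pred nat) :
  count (fun x => P x.1) (color_cells s c r) =
  (\sum_(i < n) P i * (\sum_p yz_mnm (s p) (c p))%MM (enum_rank (inl (i, r) : V)))%N.
Proof.
rewrite count_map count_filter -sum1_count big_enum_cond big_mkcond /=.
under [RHS]eq_bigr do rewrite mnm_sumE big_distrr.
rewrite exchange_big; apply: eq_bigr => p _ /=.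
rewrite (bigD1 (rowi (s p))) //= big1 => [|i /negPf ri].
  rewrite mnmDE !mnm1E !(inj_eq enum_rank_inj) /= !addn0.
  by rewrite -[inl _ == inl _]/((_, _) == (_, _)) xpair_eqE eqxx /=; case: (P _) => //=; case: eqP.
rewrite mnmDE !mnm1E !(inj_eq enum_rank_inj) /= addn0.
by rewrite -[inl _ == inl _]/((_, _) == (_, _)) xpair_eqE eq_sym ri muln0.
Qed.

Lemma color_col d (s : 'I_d -> 'I_(n * n)) c r (P : pred nat) :
  count (fun x => P x.2) (color_cells s c r) =
  (\sum_(i < n) P i * (\sum_p yz_mnm (s p) (c p))%MM (enum_rank (inr (r, i) : V)))%N.
Proof.
rewrite count_map count_filter -sum1_count big_enum_cond big_mkcond /=.
under [RHS]eq_bigr do rewrite mnm_sumE big_distrr.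
rewrite exchange_big; apply: eq_bigr => p _ /=.
rewrite (bigD1 (coli (s p))) //= big1 => [|i /negPf ri].
  rewrite mnmDE !mnm1E !(inj_eq enum_rank_inj) /= !addn0 add0n.
  by rewrite -[inr _ == inr _]/((_, _) == (_, _)) xpair_eqE eqxx andbT /=; case: (P _) => //=; case: eqP.
rewrite mnmDE !mnm1E !(inj_eq enum_rank_inj) /= add0n.
by rewrite -[inr _ == inr _]/((_, _) == (_, _)) xpair_eqE [X in _ && X]eq_sym ri andbF muln0.
Qed.

Lemma color_weight d (s : 'I_d -> 'I_(n * n)) (c : 'I_d -> 'I_k) :
  mnm_weight (\sum_p U_(s p))%MM = (\sum_r seq_weight (color_cells s c r))%N.
Proof.
rewrite mnm_weight_sum /seq_weight big_map.
under [RHS]eq_bigr do rewrite big_map big_filter big_enum_cond big_mkcond.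
rewrite exchange_big; apply: eq_bigr => p _ /=.
rewrite (bigD1 (c p)) //= eqxx big1 ?addn0 // => r /negPf.
by rewrite eq_sym => ->.
Qed.

Lemma color_perm d0 (s0 : 'I_d0 -> 'I_(n * n)) c0 d (s : 'I_d -> 'I_(n * n)) c :
  (\sum_p yz_mnm (s p) (c p) = \sum_p yz_mnm (s0 p) (c0 p))%MM ->
  (forall p q, c0 p = c0 q -> ~~ cell_lt (cell_of (s0 p)) (cell_of (s0 q))) ->
  (mnm_weight (\sum_p U_(s p)) <= mnm_weight (\sum_p U_(s0 p))%MM)%N ->
  forall r, perm_eq (color_cells s0 c0 r) (color_cells s c r).
Proof.
move=> E anti; rewrite (color_weight s c) (color_weight s0 c0) => le.
have H r : (seq_weight (color_cells s0 c0 r) <= seq_weight (color_cells s c r))%N /\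
   ((seq_weight (color_cells s c r) <= seq_weight (color_cells s0 c0 r))%N ->
    perm_eq (color_cells s0 c0 r) (color_cells s c r)).
  apply: (@antichain_weight n).
  - by split=> P; rewrite ?color_row ?color_col E.
  - by move=> x /mapP[p _ ->]; exact: cell_of_lt.
  move=> x y /mapP[p + ->] /mapP[q + ->]; rewrite !mem_filter.
  by move=> /andP[/eqP cp _] /andP[/eqP cq _]; apply: anti; rewrite cp.
move=> r; apply: (H r).2.
have /leqif_sum := fun (i : 'I_k) (_ : true) => leqif_eq (H i).1.
move=> -[_]; rewrite eqn_leq le andbT leq_sum; last by move=> i _; exact: (H i).1.
by move=> /esym /forallP /(_ r) /eqP ->.
Qed.

Lemma color_count d (s : 'I_d -> 'I_(n * n)) (c : 'I_d -> 'I_k) x :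
  (\sum_p U_(s p))%MM x = (\sum_r count_mem (cell_of x) (color_cells s c r))%N.
Proof.
rewrite mnm_sumE.
under [RHS]eq_bigr do rewrite count_map count_filter -sum1_count big_enum_cond big_mkcond.
rewrite exchange_big; apply: eq_bigr => p _ /=.
rewrite (bigD1 (c p)) //= eqxx andbT (inj_eq (@cell_of_inj n)) mnm1E big1 ?addn0.
  by case: eqP.
by move=> r /negPf; rewrite eq_sym => ->; rewrite andbF.
Qed.

Definition chain_below (u : 'X_{1..n * n}) l (x : 'I_(n * n)) : bool :=
  `[< exists t : seq 'I_(n * n), [/\ size t = l,
      path (fun a b => cell_lt (cell_of b) (cell_of a)) x t
      & {in t, forall y, 0 < u y}%N] >].

Definition height u x : nat := \sum_(l < k) chain_below u l.+1 x.

Lemma chain_belowS (u : 'X_{1..n * n}) l x y : (0 < u x)%N -> cell_lt (cell_of x) (cell_of y) ->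
  chain_below u l x -> chain_below u l.+1 y.
Proof.
move=> ux xy /asboolP[t [st pt ut]]; apply/asboolP; exists (x :: t).
by split; rewrite /= ?st ?xy // => z; rewrite inE => /predU1P[->|/ut].
Qed.

Lemma chain_belowk (u : 'X_{1..n * n}) x : ~ has_chain k u -> (0 < u x)%N -> ~~ chain_below u k x.
Proof.
move=> nc ux; apply/asboolP => -[t [st pt ut]]; apply: nc.
pose w := rev (x :: t).
have sw : size w = k.+1 by rewrite size_rev /= st.
have lt_tr : transitive (fun a b : 'I_(n * n) => cell_lt (cell_of a) (cell_of b)).
  by move=> b a c; rewrite /cell_lt; lia.
have srt : sorted (fun a b => cell_lt (cell_of a) (cell_of b)) w.
  by rewrite rev_sorted.
have lt (i j : 'I_k.+1) : (i < j)%N -> cell_lt (cell_of (nth x w i)) (cell_of (nth x w j)).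
  by move=> ij; have := sorted_ltn_nth lt_tr x srt i j; rewrite !inE sw !ltn_ord => H; exact: H.
exists (fun i => rowi (nth x w i)), (fun i => coli (nth x w i)); split.
- by move=> i j /lt /andP[].
- by move=> i j /lt /andP[].
move=> i; rewrite index_rowcol.
have : nth x w i \in w by rewrite mem_nth ?sw.
by rewrite mem_rev inE => /predU1P[->|/ut].
Qed.

Lemma height_lt (u : 'X_{1..n * n}) x : ~ has_chain k u -> (0 < u x)%N -> (height u x < k)%N.
Proof.
move=> nc ux; have := chain_belowk nc ux; rewrite /height.
case: k => [|l] nb.
  by case/negP: nb; apply/asboolP; exists [::].
rewrite big_ord_recr /= (negPf nb) addn0 ltnS.
rewrite -[X in (_ <= X)%N](card_ord l) -sum1_card; apply: leq_sum => i _.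
exact: leq_b1.
Qed.

Lemma height_mono (u : 'X_{1..n * n}) x y : ~ has_chain k u -> (0 < u x)%N -> (0 < u y)%N ->
  cell_lt (cell_of x) (cell_of y) -> (height u x < height u y)%N.
Proof.
move=> nc ux uy xy; have := chain_belowk nc ux; rewrite /height.
have b0 : chain_below u 0 x by apply/asboolP; exists [::].
case: k => [|l] nb; first by rewrite b0 in nb.
rewrite big_ord_recr /= (negPf nb) addn0 big_ord_recl /=.
rewrite (chain_belowS ux xy b0) add1n ltnS; apply: leq_sum => i _.
rewrite /bump /= add1n; case: (boolP (chain_below u i.+1 x)) => // h.
by rewrite (chain_belowS ux xy h).
Qed.

Lemma yz_map_reduced (f : A) :
  (forall m, has_chain k m -> f@_m = 0) -> yz_map f = 0 -> f = 0.
Proof.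
move=> fc f0; apply/eqP; rewrite -msupp_eq0; apply/eqP/nilP/negPn/negP => nz.
have [m1 m1f] : exists m, m \in msupp f.
  by case: (msupp f) nz => // a l _; exists a; rewrite inE eqxx.
have [u uf umax] : exists2 u, u \in msupp f &
    forall m, m \in msupp f -> (mnm_weight m <= mnm_weight u)%N.
  have := @arg_maxnP _ (SeqSub m1f) xpredT (fun a => mnm_weight (val a)) isT.
  case=> a _ amax; exists (val a); first exact: valP.
  by move=> m mf; apply: (amax (SeqSub mf)).
have nc : ~ has_chain k u.
  by move=> /fc /eqP; rewrite mcoeff_eq0 uf.
pose d0 := size (mnm_seq u).
pose s0 (p : 'I_d0) := tnth (in_tuple (mnm_seq u)) p.
have us0 p : (0 < u (s0 p))%N by apply: mnm_seq_mem; exact: mem_tnth.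
pose c0 p : 'I_k := Ordinal (height_lt nc (us0 p)).
have anti p q : c0 p = c0 q -> ~~ cell_lt (cell_of (s0 p)) (cell_of (s0 q)).
  move=> /(congr1 val) /= E; apply/negP => /(height_mono nc (us0 p) (us0 q)).
  by rewrite E ltnn.
have tupE m : m = (\sum_(p < size (mnm_seq m)) U_(tnth (in_tuple (mnm_seq m)) p))%MM.
  by rewrite {1}[m]mnm_seqE big_tnth.
have uE : u = (\sum_p U_(s0 p))%MM by exact: tupE.
pose t := (\sum_p yz_mnm (s0 p) (c0 p))%MM.
have cu : (yz_map 'X_[u])@_t = 1.
  rewrite {1}uE yz_coef (bigD1 (finfun c0)) //= [X in _ + X]big1 => [|c cN].
    rewrite addr0 (_ : bigop.body _ _ _ = t) ?eqxx //.
    by apply: eq_bigr => p _; rewrite ffunE.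
  case: eqP => // E; case/eqP: cN; apply/ffunP => p; rewrite ffunE.
  have /(_ (c p)) := color_perm E anti (leqnn _).
  move=> /perm_mem /(_ (cell_of (s0 p))).
  have -> : cell_of (s0 p) \in color_cells s0 c (c p).
    by apply: map_f; rewrite mem_filter eqxx mem_enum.
  move=> /mapP[q]; rewrite mem_filter => /andP[/eqP cq _] /cell_of_inj Eq.
  by rewrite -cq; apply: val_inj; rewrite /= Eq.
have cm m : m \in msupp f -> m != u -> (yz_map 'X_[m])@_t = 0.
  move=> mf mu; rewrite {1}(tupE m) yz_coef big1 // => c _.
  case: eqP => // E; case/eqP: mu; apply/mnmP => x.
  have le := umax _ mf; rewrite (tupE m) uE in le *.
  rewrite (color_count _ c) (color_count _ c0); apply: eq_bigr => r _.
  by have /seq.permP -> := color_perm E anti le r.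
have := congr1 (mcoeff t) f0; rewrite mcoeff0 {1}[f]mpolyE rmorph_sum raddf_sum /=.
rewrite (bigD1_seq u) ?msupp_uniq //= big1_seq => [|m /andP[mu mf]].
  rewrite -mul_mpolyC rmorphM /= /yz_map mmapC -/yz_map mcoeffCM cu mulr1 addr0.
  by move/eqP; rewrite mcoeff_eq0 uf.
by rewrite -mul_mpolyC rmorphM /= /yz_map mmapC -/yz_map mcoeffCM cm ?mulr0.
Qed.

Lemma det_idealE p : (p \in det_ideal K n k) = (yz_map p == 0).
Proof.
apply/idP/eqP => [|p0]; first exact: yz_map_ideal.
have [f pf fc] := reducibleP k p.
suff f0 : f = 0 by rewrite f0 subr0 in pf.
apply: yz_map_reduced fc _.
by have := yz_map_ideal pf; rewrite rmorphB /= p0 sub0r => /eqP; rewrite oppr_eq0 => /eqP.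
Qed.

Lemma det_ideal_prime : prime_idealr_closed (det_ideal K n k).
Proof. by move=> u v; rewrite !det_idealE rmorphM mulf_eq0. Qed.

End GenericRank.

HB.instance Definition _ (K : fieldType) (n k : nat) :=
  isPrimeIdealrClosed.Build {mpoly K[n * n]} (det_ideal K n k)
    (@det_ideal_prime K n k).

(* {ideal_quot _} only carries a comNzRingType structure; primality makes it an
   integral domain, with classically decided units. *)
Definition det_ring (K : fieldType) (n k : nat) : Type :=
  {ideal_quot (det_ideal K n k)}.

Section DeterminantalRing.
Variables (K : fieldType) (n k : nat).
Local Notation R := (det_ring K n k).

HB.instance Definition _ := GRing.ComNzRing.on R.

Definition det_unit : pred R := fun x => `[< exists y : R, y * x = 1 >].
Definition det_inv (x : R) : R :=
  if pselect (exists y : R, y * x = 1) is left h then sval (cid h) else x.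

Lemma det_mulVr : {in det_unit, left_inverse 1 det_inv *%R}.
Proof.
by move=> x /asboolP h; rewrite /det_inv; case: pselect => // h'; case: cid.
Qed.

Lemma det_unitP (x y : R) : y * x = 1 -> det_unit x.
Proof. by move=> yx; apply/asboolP; exists y. Qed.

Lemma det_inv_out : {in [predC det_unit], det_inv =1 id}.
Proof.
by move=> x /asboolP h; rewrite /det_inv; case: pselect => // h'; case: h.
Qed.

HB.instance Definition _ :=
  GRing.ComNzRing_hasMulInverse.Build R det_mulVr det_unitP det_inv_out.

Lemma det_integral (x y : R) : x * y = 0 -> (x == 0) || (y == 0).
Proof.
elim/quotW: x => x; elim/quotW: y => y.
have E z : (\pi_R z == 0 :> R) = (z \in det_ideal K n k).
  by rewrite -[RHS]/(z \in (det_ideal K n k : idealr _))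
             -[in RHS](subr0 z) Quotient.idealrBE !piE.
have /= -> : (\pi_R x * \pi_R y : R) = \pi_R (x * y).
  exact: esym (Quotient.pi_mul (det_ideal K n k : idealr _) x y).
by move/eqP; rewrite !E => /det_ideal_prime.
Qed.

HB.instance Definition _ :=
  GRing.ComUnitRing_isIntegral.Build R det_integral.

End DeterminantalRing.

Section Brackets.

(* The biderivation of {mpoly K[N]} whose value on the variables indexed by
   s and t is Q s t, when x is a numbering of the variables by T. *)
Definition mpoly_bracket (K : fieldType) (N : nat) (T : finType)
    (x : T -> 'I_N) (Q : T -> T -> {mpoly K[N]}) (f g : {mpoly K[N]}) :
    {mpoly K[N]} :=
  \sum_s \sum_t Q s t * mderiv (x s) f * mderiv (x t) g.

Definition num_bracket (R : idomainType) (br : R -> R -> R) (a b c d : R) : R :=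
  br a c * b * d - br a d * b * c - br b c * a * d + br b d * a * c.

(* The quotient rule {a/b, c/d}, computed on representatives; it does not
   depend on them when br is a biderivation, see frac_bracketE. *)
Definition frac_bracket (R : idomainType) (br : R -> R -> R)
    (u v : {fraction R}) : {fraction R} :=
  let a := \n_(repr u) in let b := \d_(repr u) in
  let c := \n_(repr v) in let d := \d_(repr v) in
  FracField.tofrac (num_bracket br a b c d) /
  FracField.tofrac ((b * d) ^+ 2).

End Brackets.

Section MatrixBracket.
Variables (K : fieldType) (n : nat).
Local Notation X := (Xmat K n).
Implicit Types p q : 'I_n * 'I_n.

Definition lex_lt p q : bool :=
  (p.1 < q.1)%N || ((p.1 == q.1) && (p.2 < q.2)%N).

(* {X_lm, X_ij} for (i,j) smaller than (l,m) *)
Definition mat_bracket_gt (l m i j : 'I_n) : {mpoly K[n * n]} :=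
  if (l > i)%N && (m == j) then - (X i j * X l m)
  else if (l == i) && (m > j)%N then - (X i j * X l m)
  else if (l > i)%N && (m < j)%N then 0
  else (* l > i and m > j *) - (2%:R * (X i m * X l j)).

Definition mat_bracket_gen p q : {mpoly K[n * n]} :=
  if lex_lt q p then mat_bracket_gt p.1 p.2 q.1 q.2
  else if lex_lt p q then - mat_bracket_gt q.1 q.2 p.1 p.2
  else 0.

Definition mat_bracket : {mpoly K[n * n]} -> {mpoly K[n * n]} ->
    {mpoly K[n * n]} :=
  mpoly_bracket (fun p => mxvec_index p.1 p.2) mat_bracket_gen.

End MatrixBracket.

(* Independent of the representatives because det_ideal is a Poisson ideal,
   see det_bracketE. *)
Definition det_bracket (K : fieldType) (n k : nat)
    (u v : det_ring K n k) : det_ring K n k :=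
  \pi_(det_ring K n k) (mat_bracket (repr u) (repr v)).

Definition log_bracket (K : fieldType) (m : nat) (mu : 'M[K]_m) :
    {mpoly K[m]} -> {mpoly K[m]} -> {mpoly K[m]} :=
  mpoly_bracket id (fun i j : 'I_m => mu i j *: ('X_i * 'X_j)).

Definition det_const (K : fieldType) (n k : nat) (c : K) :
    {fraction (det_ring K n k)} :=
  FracField.tofrac (\pi_(det_ring K n k) (mpolyC (n * n) c) : det_ring K n k).

Definition rat_const (K : fieldType) (m : nat) (c : K) :
    {fraction {mpoly K[m]}} :=
  FracField.tofrac (mpolyC m c).

(* Isomorphism of K-algebras with bracket; iota1 and iota2 are the structure
   maps. *)
Definition poisson_isomorphic (K F1 F2 : fieldType)
    (iota1 : K -> F1) (br1 : F1 -> F1 -> F1)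
    (iota2 : K -> F2) (br2 : F2 -> F2 -> F2) : Prop :=
  exists psi : {rmorphism F1 -> F2},
    [/\ bijective psi, forall c, psi (iota1 c) = iota2 c
      & forall u v, psi (br1 u v) = br2 (psi u) (psi v)].

Section BracketTheory.
Variables (K : fieldType) (N : nat) (T : finType).
Variables (x : T -> 'I_N) (Q : T -> T -> {mpoly K[N]}).
Local Notation br := (mpoly_bracket x Q).

Lemma mderiv_var (i j : 'I_N) :
  mderiv i ('X_j : {mpoly K[N]}) = (i == j)%:R.
Proof.
rewrite mderivX mnm1E eq_sym; case: eqP => [->|_]; last by rewrite scale0r.
have -> : (U_(j) - U_(j) = 0)%MM by apply/mnmP => a; rewrite mnmBE mnm0E subnn.
by rewrite scale1r mpolyX0.
Qed.

Lemma mpoly_bracketX s t : injective x -> br 'X_(x s) 'X_(x t) = Q s t.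
Proof.
move=> xI; have E a b : mderiv (x a) 'X_(x b) = (a == b)%:R :> {mpoly K[N]}.
  by rewrite mderiv_var (inj_eq xI).
rewrite /mpoly_bracket (bigD1 s) //= [X in _ + X]big1 ?addr0; last first.
  by move=> a /negPf sa; rewrite big1 // => b _; rewrite E sa mulr0 mul0r.
rewrite (bigD1 t) //= big1 ?addr0 ?E ?eqxx ?mulr1 // => a /negPf ta.
by rewrite [X in _ * X]E ta mulr0.
Qed.

Lemma mpoly_bracketDr f : {morph br f : g h / g + h}.
Proof.
move=> g h; rewrite -big_split; apply: eq_bigr => s _ /=.
by rewrite -big_split; apply: eq_bigr => t _; rewrite mderivD mulrDr.
Qed.

Lemma mpoly_bracketCr f c : br f c%:MP = 0.
Proof. by rewrite /mpoly_bracket big1 // => s _; rewrite big1 // => t _; rewrite mderivC mulr0. Qed.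

Lemma mpoly_bracketMr f g h : br f (g * h) = br f g * h + g * br f h.
Proof.
rewrite /mpoly_bracket mulr_suml mulr_sumr -big_split.
apply: eq_bigr => s _; rewrite mulr_suml mulr_sumr -big_split.
by apply: eq_bigr => t _; rewrite mderivM /=; ring.
Qed.

Lemma mpoly_bracketN f g : (forall s t, Q s t = - Q t s) -> br g f = - br f g.
Proof.
move=> QN; rewrite /mpoly_bracket exchange_big /= -sumrN; apply: eq_bigr => s _.
by rewrite -sumrN; apply: eq_bigr => t _; rewrite (QN t); ring.
Qed.

Lemma mpoly_bracketEl f g : injective x ->
  br f g = \sum_s mderiv (x s) f * br 'X_(x s) g.
Proof.
move=> xI; rewrite {1}/mpoly_bracket; apply: eq_bigr => s _.
have -> : br 'X_(x s) g = \sum_t Q s t * mderiv (x t) g.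
  rewrite /mpoly_bracket (bigD1 s) //= [X in _ + X]big1 ?addr0.
    by apply: eq_bigr => t _; rewrite mderiv_var eqxx mulr1.
  move=> a /negPf sa; rewrite big1 // => b _.
  by rewrite mderiv_var (inj_eq xI) sa mulr0 mul0r.
by rewrite mulr_sumr; apply: eq_bigr => t _; ring.
Qed.

End BracketTheory.

Section FracBracketTheory.
Variables (R : idomainType) (br : R -> R -> R).
Hypothesis brMl : forall a b c, br (a * b) c = br a c * b + a * br b c.
Hypothesis brMr : forall a b c, br a (b * c) = br a b * c + b * br a c.
Local Notation "x %:F" := (FracField.tofrac x).

Lemma tofrac_repr (u : {fraction R}) : u = (\n_(repr u))%:F / (\d_(repr u))%:F.
Proof.
have d0 : \d_(repr u) != 0 by exact: denom_ratioP.
apply: (mulIf (x := (\d_(repr u))%:F)); first by rewrite tofrac_eq0.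
rewrite divfK ?tofrac_eq0 // -{1}[u]reprK; unlock FracField.tofrac.
rewrite -[LHS]FracField.pi_mul; apply/eqmodP; rewrite /= FracField.equivfE.
by rewrite /FracField.mulf !numden_Ratio ?mulf_neq0 ?oner_neq0 // !mulr1 mulrC.
Qed.

Lemma quotient_rule (D : R -> R) (a b a' b' : R) :
  (forall f g, D (f * g) = D f * g + f * D g) -> a * b' = a' * b ->
  (D a * b - D b * a) * b' ^+ 2 = (D a' * b' - D b' * a') * b ^+ 2.
Proof.
move=> DM E; have := congr1 D E; rewrite !DM => DE.
apply/eqP; rewrite -subr_eq0; apply/eqP.
transitivity (b * b' * ((D a * b' + a * D b') - (D a' * b + a' * D b))
  - (D b * b' + b * D b') * (a * b' - a' * b)); first by ring.
by rewrite DE E !subrr !mulr0 subrr.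
Qed.

Lemma frac_bracketE (a b c d : R) : b != 0 -> d != 0 ->
  frac_bracket br (a%:F / b%:F) (c%:F / d%:F) =
  (num_bracket br a b c d)%:F / ((b * d) ^+ 2)%:F.
Proof.
move=> b0 d0; rewrite /frac_bracket.
set u := a%:F / b%:F; set v := c%:F / d%:F.
move: (tofrac_repr u) (tofrac_repr v) (denom_ratioP (repr u)) (denom_ratioP (repr v)).
move: (\n_(repr u)) (\d_(repr u)) (\n_(repr v)) (\d_(repr v)) => a' b' c' d'.
rewrite {}/u {}/v => /eqP + /eqP + b'0 d'0.
rewrite !eqr_div ?tofrac_eq0 // -!tofracM !tofrac_eq => /eqP Eu /eqP Ev.
apply/eqP; rewrite eqr_div ?tofrac_eq0 ?expf_neq0 ?mulf_neq0 //.
rewrite -!tofracM tofrac_eq; apply/eqP.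
have H1 e := quotient_rule (D := br^~ e) (fun f g => brMl f g e) Eu.
have H2 e := quotient_rule (D := br e) (brMr e) Ev.
transitivity (((br a c' * b - br b c' * a) * b' ^+ 2 * d'
   - (br a d' * b - br b d' * a) * b' ^+ 2 * c') * d ^+ 2).
  by rewrite !H1 /num_bracket; ring.
transitivity (((br a c' * d' - br a d' * c') * d ^+ 2 * b
   - (br b c' * d' - br b d' * c') * d ^+ 2 * a) * b' ^+ 2); first by ring.
by rewrite -!H2 /num_bracket; ring.
Qed.

Lemma frac_bracket_tofrac a c : frac_bracket br a%:F c%:F = (br a c)%:F.
Proof.
have br1l e : br 1 e = 0.
  by apply: (addrI (br 1 e)); rewrite addr0 -{3}(mulr1 1) brMl mulr1 mul1r.
have br1r e : br e 1 = 0.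
  by apply: (addrI (br e 1)); rewrite addr0 -{3}(mulr1 1) brMr mulr1 mul1r.
have E e : e%:F = e%:F / (1 : R)%:F by rewrite tofrac1 divr1.
rewrite {1}(E a) {1}(E c) frac_bracketE ?oner_eq0 // /num_bracket.
by rewrite !(br1l, br1r) !mulr1 !mul0r !subr0 addr0 expr1n tofrac1 divr1.
Qed.

End FracBracketTheory.

Section DetPoissonIdeal.
Variables (K : fieldType) (n : nat).
Local Notation A := {mpoly K[n * n]}.
Local Notation X := (Xmat K n).
Local Notation idx := (fun p : 'I_n * 'I_n => mxvec_index p.1 p.2).

Lemma mat_idx_inj : injective idx.
Proof.
move=> [i j] [l m] /= /(congr1 val) E.
have := mxvecE (\matrix_(a, b) ((a, b) : 'I_n * 'I_n)) i j.
have -> : mxvec_index i j = mxvec_index l m by apply: val_inj.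
by rewrite mxvecE !mxE.
Qed.

Lemma mat_bracketX (i j l m : 'I_n) :
  mat_bracket (X i j) (X l m) = mat_bracket_gen K (i, j) (l, m).
Proof.
rewrite !mxE.
exact: (mpoly_bracketX (mat_bracket_gen K (n := n)) (i, j) (l, m) mat_idx_inj).
Qed.

Definition nat_sg (a b : nat) : A :=
  if (b < a)%N then 1 else if (a < b)%N then -1 else 0.

Lemma mat_bracket_genE (i j l m : 'I_n) :
  mat_bracket_gen K (l, m) (i, j) =
  - ((nat_sg l i + nat_sg m j) * (X i m * X l j)).
Proof.
rewrite /mat_bracket_gen /mat_bracket_gt /lex_lt /nat_sg /= -!val_eqE /=.
case: (ltngtP l i) => li; case: (ltngtP m j) => mj //=;
  try have {}li := val_inj li; try have {}mj := val_inj mj; subst; ring.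
Qed.

Lemma mat_bracket_gen_skew p q :
  mat_bracket_gen K (n := n) p q = - mat_bracket_gen K q p.
Proof.
case: p q => [l m] [i j]; rewrite !mat_bracket_genE /nat_sg.
case: (ltngtP l i) => li; case: (ltngtP m j) => mj //=;
  try have {}li := val_inj li; try have {}mj := val_inj mj; subst; ring.
Qed.

Lemma det_derivation r (D : A -> A) (M : 'M[A]_r) :
    (forall p q, D (p + q) = D p + D q) ->
    (forall p q, D (p * q) = D p * q + p * D q) ->
  D (\det M) = \sum_i \sum_j D (M i j) * cofactor M i j.
Proof.
move=> DD DM.
have D0 : D 0 = 0 by apply: (addrI (D 0)); rewrite -DD !addr0.
have D1 : D 1 = 0.
  by apply: (addrI (D 1)); rewrite addr0 -{3}(mulr1 1) DM mulr1 mul1r.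
have DN p : D (- p) = - D p.
  by apply: (addrI (D p)); rewrite -DD !subrr.
have Dsum (I : Type) (s : seq I) (P : pred I) F :
    D (\sum_(i <- s | P i) F i) = \sum_(i <- s | P i) D (F i).
  by apply: big_morph.
have Dprod (I : eqType) (s : seq I) (F : I -> A) : uniq s ->
    D (\prod_(i <- s) F i) =
    \sum_(i <- s) D (F i) * \prod_(j <- s | j != i) F j.
  elim: s => [|a s IH] /=; first by rewrite !big_nil.
  move=> /andP[aNs us]; rewrite !big_cons DM IH //= eqxx /=; congr (_ * _ + _).
    rewrite [RHS]big_seq_cond [LHS]big_seq; apply: eq_bigl => b.
    by case: eqP => [->|]; rewrite ?(negPf aNs) ?andbT.
  rewrite mulr_sumr; apply: eq_big_seq => b bs.
  rewrite big_cons; case: eqP => [ab|_]; first by rewrite -ab (negPf aNs) in bs *.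
  by rewrite mulrCA.
pose N (i : 'I_r) : 'M[A]_r :=
  \matrix_(a, b) if a == i then D (M i b) else M a b.
transitivity (\sum_i \det (N i)).
  rewrite /determinant Dsum exchange_big /=; apply: eq_bigr => s _.
  have -> : (-1) ^+ s * \prod_i M i (s i) =
      (if s : bool then - \prod_i M i (s i) else \prod_i M i (s i)).
    by case: (s : bool); rewrite ?expr1 ?expr0 ?mulN1r ?mul1r.
  have -> : \sum_i (-1) ^+ s * \prod_a N i a (s a) =
      (-1) ^+ s * \sum_i D (M i (s i)) * \prod_(a | a != i) M a (s a).
    rewrite mulr_sumr; apply: eq_bigr => i _; congr (_ * _).
    rewrite (bigD1 i) //= !mxE eqxx; congr (_ * _).
    by apply: eq_bigr => a /negPf ai; rewrite mxE ai.
  rewrite -(Dprod _ (index_enum 'I_r) (fun i => M i (s i))) ?index_enum_uniq //.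
  by case: (s : bool); rewrite ?DN ?expr1 ?expr0 ?mulN1r ?mul1r.
apply: eq_bigr => i _; rewrite (expand_det_row _ i); apply: eq_bigr => j _.
rewrite mxE eqxx /cofactor; congr (_ * (_ * \det _)).
apply/matrixP => a b; rewrite !mxE.
by have /negPf -> : lift i a != i by rewrite eq_sym neq_lift.
Qed.

Lemma det_ideal_minor k (l m : 'I_n) (f g : 'I_k.+1 -> 'I_n) :
  mat_bracket (X l m) (\det (mxsub f g X)) \in det_ideal K n k.
Proof.
rewrite (@det_derivation _ (mat_bracket (X l m))); last 2 first.
- exact: mpoly_bracketDr.
- exact: mpoly_bracketMr.
set M := mxsub f g X.
pose M1 i := mxsub (fun a => if a == i then l else f a) g X.
pose M2 j := mxsub f (fun b => if b == j then m else g b) X.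
have -> : \sum_i \sum_j mat_bracket (X l m) (M i j) * cofactor M i j =
    \sum_i - (nat_sg l (f i) * X (f i) m) * \det (M1 i) +
    \sum_j - (nat_sg m (g j) * X l (g j)) * \det (M2 j).
  have E1 i : \det (M1 i) = \sum_j X l (g j) * cofactor M i j.
    rewrite (expand_det_row _ i); apply: eq_bigr => j _.
    rewrite !mxE eqxx /cofactor; congr (_ * (_ * \det _)).
    apply/matrixP => a b; rewrite !mxE.
    by have /negPf -> : lift i a != i by rewrite eq_sym neq_lift.
  have E2 j : \det (M2 j) = \sum_i X (f i) m * cofactor M i j.
    rewrite (expand_det_col _ j); apply: eq_bigr => i _.
    rewrite !mxE eqxx /cofactor; congr (_ * (_ * \det _)).
    apply/matrixP => a b; rewrite !mxE.
    by have /negPf -> : lift j b != j by rewrite eq_sym neq_lift.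
  under [X in _ = X + _]eq_bigr do rewrite E1 mulr_sumr.
  under [X in _ = _ + X]eq_bigr do rewrite E2 mulr_sumr.
  rewrite [X in _ = _ + X]exchange_big -big_split; apply: eq_bigr => i _ /=.
  rewrite -big_split; apply: eq_bigr => j _ /=.
  by rewrite [M i j]mxE mat_bracketX mat_bracket_genE; ring.
apply: det_idealD; apply: det_ideal_sum => i _; apply: det_idealM;
  exact: det_ideal_mxsub.
Qed.

Lemma det_ideal_poisson k a u :
  u \in det_ideal K n k -> mat_bracket a u \in det_ideal K n k.
Proof.
move=> /asboolP[s sP ->].
have D0 : mat_bracket a 0 = 0 by rewrite -mpolyC0; exact: mpoly_bracketCr.
have DD : {morph mat_bracket a : g h / g + h} by exact: mpoly_bracketDr.
rewrite (big_morph (mat_bracket a) DD D0).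
rewrite big_seq; apply: det_ideal_sum => c /sP [f [g [_ _ ->]]].
rewrite /mat_bracket mpoly_bracketMr; apply: det_idealD.
  by apply: det_idealM; exact: det_ideal_mxsub.
apply: det_idealM; rewrite (mpoly_bracketEl _ _ _ mat_idx_inj).
apply: det_ideal_sum => -[l m] _; apply: det_idealM.
by have := det_ideal_minor l m f g; rewrite mxE.
Qed.

End DetPoissonIdeal.

Section DetBracketTheory.
Variables (K : fieldType) (n k : nat).
Local Notation R := (det_ring K n k).

Lemma mat_bracketN (f g : {mpoly K[n * n]}) :
  mat_bracket g f = - mat_bracket f g.
Proof. by apply: mpoly_bracketN => p q; exact: mat_bracket_gen_skew. Qed.

Lemma det_bracketE (a b : {mpoly K[n * n]}) :
  det_bracket (\pi_R a : R) (\pi_R b : R) = \pi_R (mat_bracket a b).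
Proof.
have I c d : (\pi_R c == \pi_R d) = (c - d \in det_ideal K n k).
  by rewrite -[RHS]/(c - d \in (det_ideal K n k : idealr _))
             Quotient.idealrBE.
have C c d e : \pi_R c = \pi_R d ->
    \pi_R (mat_bracket e c) = \pi_R (mat_bracket e d) /\
    \pi_R (mat_bracket c e) = \pi_R (mat_bracket d e).
  move=> /eqP; rewrite I => cd.
  have B : mat_bracket e c - mat_bracket e d = mat_bracket e (c - d).
    rewrite -[c in LHS](subrK d) /mat_bracket mpoly_bracketDr.
    by rewrite addrK.
  split; apply/eqP; rewrite I; last first.
    rewrite mat_bracketN [mat_bracket d e]mat_bracketN -opprD -mulN1r.
    by rewrite B; apply: det_idealM; exact: det_ideal_poisson.
  by rewrite B; exact: det_ideal_poisson.
rewrite /det_bracket.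
rewrite (C _ b (repr (\pi_R a : R)) _).1 ?reprK //.
by rewrite (C _ a b _).2 ?reprK.
Qed.

Lemma det_bracketMr (u v w : R) :
  det_bracket u (v * w) = det_bracket u v * w + v * det_bracket u w.
Proof.
have piM a b : \pi_R a * \pi_R b = \pi_R (a * b) :> R.
  exact: esym (Quotient.pi_mul (det_ideal K n k : idealr _) a b).
have piD a b : \pi_R a + \pi_R b = \pi_R (a + b) :> R.
  exact: esym (Quotient.pi_add (det_ideal K n k : zmodClosed _) a b).
elim/quotW: u => a; elim/quotW: v => b; elim/quotW: w => c.
rewrite piM !det_bracketE; apply: etrans (congr1 _ (mpoly_bracketMr _ _ a b c)) _.
by rewrite -piD -!piM.
Qed.

Lemma det_bracketN (u v : R) : det_bracket v u = - det_bracket u v.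
Proof.
have piN a : - \pi_R a = \pi_R (- a) :> R.
  exact: esym (Quotient.pi_opp (det_ideal K n k : zmodClosed _) a).
elim/quotW: u => a; elim/quotW: v => b.
by rewrite !det_bracketE mat_bracketN -piN.
Qed.

Lemma det_bracketMl (u v w : R) :
  det_bracket (u * v) w = det_bracket u w * v + u * det_bracket v w.
Proof.
rewrite -[LHS]opprK -det_bracketN det_bracketMr opprD -mulNr -mulrN.
by rewrite -!det_bracketN.
Qed.

End DetBracketTheory.

Arguments det_bracket : clear implicits.
Arguments det_const : clear implicits.
Arguments rat_const : clear implicits.

(* Main.v *)
(* The coordinates are the initial minors D_(i,j): the solid minors with lower
   right corner (i,j) that reach the first row or the first column. Since
   {X_ab, X_cd} = - (sg(a,c) + sg(b,d)) X_cb X_ad, the bracket of two minors is a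
   signed sum of exchanges of a row plus a signed sum of exchanges of a column.
   An exchange contributes nothing unless it brings a new row (column) to both
   minors, and for intervals of rows (columns) all such exchanges have the same
   sign e (e'). Both unsigned sums are the same S, so the bracket is
   - (e + e') S up to a multiple of the product of the minors. If the rows or the
   columns are nested, S is itself a multiple of the product; otherwise, for
   initial minors, e = - e'.
   Modulo the minors of size k + 1 the D_(i,j) with i < k or j < k are free
   generators of the field of fractions. They generate it because D_(i,j) is
   affine in X_ij with leading coefficient D_(i-1,j-1), which gives X_ij by
   induction when i < k or j < k, while a vanishing (k+1)-minor gives it
   otherwise. They are free because the same recursion produces a matrix of
   rank k with arbitrary nonzero values of the D_(i,j). *)

Require Import Defs.
From HB Require Import structures.
From mathcomp Require Import all_boot all_order all_algebra.
From mathcomp Require Import mpoly.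
From mathcomp Require Import boolp.
From mathcomp Require Import ring zify.

Set Implicit Arguments.
Unset Strict Implicit.
Unset Printing Implicit Defensive.

Import GRing.Theory.
Local Open Scope ring_scope.
Local Open Scope quotient_scope.

(** * Morphisms and biderivations on fields of fractions *)

Section FractionExtension.
Variables (B : idomainType) (F : fieldType) (f : {rmorphism B -> F}).
Hypothesis f_inj : injective f.
Local Notation "x %:F" := (FracField.tofrac x).

(** Injectivity keeps the images of denominators nonzero, and cross-multiplication shows that the
    quotient of images does not depend on the chosen representative. *)
Lemma frac_extension :
  exists phi : {rmorphism {fraction B} -> F}, forall b, phi b%:F = f b.
Proof.
have f0 b : (f b == 0) = (b == 0) by rewrite -(inj_eq f_inj) rmorph0.
pose phi (u : {fraction B}) := f (\n_(repr u)) / f (\d_(repr u)).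
have phiE a b : b != 0 -> phi (a%:F / b%:F) = f a / f b.
  move=> b0; have d0 : \d_(repr (a%:F / b%:F)) != 0 by exact: denom_ratioP.
  have /eqP := tofrac_repr (a%:F / b%:F).
  rewrite eqr_div ?tofrac_eq0 // -!tofracM tofrac_eq => /eqP E.
  apply/eqP; rewrite eqr_div ?f0 //; apply/eqP.
  by rewrite -!rmorphM -E.
have phiF b : phi b%:F = f b.
  by rewrite -[b%:F]divr1 -tofrac1 phiE ?oner_eq0 // rmorph1 divr1.
have phiB : zmod_morphism phi.
  move=> u v; rewrite (tofrac_repr u) (tofrac_repr v).
  move: (denom_ratioP (repr u)) (denom_ratioP (repr v)).
  move: (\n_(repr u)) (\d_(repr u)) (\n_(repr v)) (\d_(repr v)) => a b c d b0 d0.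
  rewrite -mulNr addf_div ?tofrac_eq0 // -tofracN -!tofracM -tofracD.
  rewrite !phiE ?mulf_neq0 // rmorphD !rmorphM rmorphN.
  by rewrite -mulNr addf_div ?f0.
have phiM : monoid_morphism phi.
  split=> [|u v]; first by rewrite -tofrac1 phiF rmorph1.
  rewrite (tofrac_repr u) (tofrac_repr v).
  move: (denom_ratioP (repr u)) (denom_ratioP (repr v)).
  move: (\n_(repr u)) (\d_(repr u)) (\n_(repr v)) (\d_(repr v)) => a b c d b0 d0.
  by rewrite mulf_div -!tofracM !phiE ?mulf_neq0 // !rmorphM mulf_div.
pose z := GRing.isZmodMorphism.Build _ _ phi phiB.
pose m := GRing.isMonoidMorphism.Build _ _ phi phiM.
by exists (HB.pack phi z m : {rmorphism {fraction B} -> F}).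
Qed.

End FractionExtension.

(** A morphism of fields is injective, so only surjectivity has to be supplied. *)
Lemma rmorph_bij_inverse (F1 F2 : fieldType) (phi : {rmorphism F1 -> F2}) :
  (forall y, exists x, phi x = y) ->
  exists2 psi : {rmorphism F2 -> F1}, cancel phi psi & cancel psi phi.
Proof.
move=> phi_surj; pose psi y := sval (cid (phi_surj y)).
have psiK : cancel psi phi by move=> y; rewrite /psi; case: cid.
have phiK : cancel phi psi by move=> x; apply: (fmorph_inj phi).
pose z := GRing.isZmodMorphism.Build _ _ psi (can2_zmod_morphism phiK psiK).
pose m := GRing.isMonoidMorphism.Build _ _ psi (can2_monoid_morphism phiK psiK).
by exists (HB.pack psi z m : {rmorphism F2 -> F1}).
Qed.

Section FracBiderivation.
Variables (R : idomainType) (br : R -> R -> R).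
Hypothesis brDr : forall a b c, br a (b + c) = br a b + br a c.
Hypothesis brMr : forall a b c, br a (b * c) = br a b * c + b * br a c.
Hypothesis brN : forall a b, br b a = - br a b.
Local Notation "x %:F" := (FracField.tofrac x).

Let brMl a b c : br (a * b) c = br a c * b + a * br b c.
Proof. by rewrite brN brMr opprD -mulNr -mulrN -!brN. Qed.

Lemma frac_bracketN u v : frac_bracket br v u = - frac_bracket br u v.
Proof.
rewrite (tofrac_repr u) (tofrac_repr v).
move: (denom_ratioP (repr u)) (denom_ratioP (repr v)).
move: (\n_(repr u)) (\d_(repr u)) (\n_(repr v)) (\d_(repr v)) => a b c d b0 d0.
rewrite !(frac_bracketE brMl brMr) // -mulNr -tofracN mulrC [d * b]mulrC.
rewrite mulrC; congr (_%:F / _).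
rewrite /num_bracket (brN a c) (brN a d) (brN b c) (brN b d); ring.
Qed.

Lemma frac_bracketDr u v w :
  frac_bracket br u (v + w) = frac_bracket br u v + frac_bracket br u w.
Proof.
rewrite (tofrac_repr u) (tofrac_repr v) (tofrac_repr w).
move: (denom_ratioP (repr u)) (denom_ratioP (repr v)) (denom_ratioP (repr w)).
move: (\n_(repr u)) (\d_(repr u)) (\n_(repr v)) (\d_(repr v)) => a b c d.
move: (\n_(repr w)) (\d_(repr w)) => g h b0 d0 h0.
rewrite addf_div ?tofrac_eq0 // -!tofracM -tofracD.
rewrite !(frac_bracketE brMl brMr) ?mulf_neq0 //.
rewrite addf_div ?tofrac_eq0 ?expf_neq0 ?mulf_neq0 // -!tofracM -tofracD.
apply/eqP; rewrite eqr_div ?tofrac_eq0 ?mulf_neq0 ?expf_neq0 ?mulf_neq0 //.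
rewrite -!tofracM tofrac_eq /num_bracket !brDr !brMr; apply/eqP; ring.
Qed.

Lemma frac_bracketMr u v w :
  frac_bracket br u (v * w) = frac_bracket br u v * w + v * frac_bracket br u w.
Proof.
rewrite (tofrac_repr u) (tofrac_repr v) (tofrac_repr w).
move: (denom_ratioP (repr u)) (denom_ratioP (repr v)) (denom_ratioP (repr w)).
move: (\n_(repr u)) (\d_(repr u)) (\n_(repr v)) (\d_(repr v)) => a b c d.
move: (\n_(repr w)) (\d_(repr w)) => g h b0 d0 h0.
rewrite mulf_div -!tofracM.
rewrite !(frac_bracketE brMl brMr) ?mulf_neq0 //.
rewrite !mulf_div -!tofracM addf_div ?tofrac_eq0 ?mulf_neq0 ?expf_neq0 ?mulf_neq0 //.
rewrite -!tofracM -tofracD.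
apply/eqP; rewrite eqr_div ?tofrac_eq0 ?mulf_neq0 ?expf_neq0 ?mulf_neq0 //.
rewrite -!tofracM tofrac_eq /num_bracket !brMr; apply/eqP; ring.
Qed.

End FracBiderivation.

(** * Brackets on rational functions from their values on the variables *)

Lemma mpoly_closed_ind (S : comNzRingType) N (P : {mpoly S[N]} -> Prop) :
  (forall c, P c%:MP) -> (forall i, P 'X_i) ->
  (forall p q, P p -> P q -> P (p + q)) -> (forall p q, P p -> P q -> P (p * q)) ->
  forall p, P p.
Proof.
move=> PC PX PD PM p.
rewrite [p]mpolyE; apply: (big_ind P) => [||q _]; first by rewrite -mpolyC0.
- exact: PD.
rewrite -mul_mpolyC; apply: (PM) => //; rewrite mpolyXE_id.
apply: (big_ind P) => [||i _]; [by rewrite -mpolyC1|exact: PM|].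
by elim: (q i) => [|d IH]; rewrite ?expr0 -?mpolyC1 // exprS; apply: (PM).
Qed.

Lemma rmorph_mpoly_ext (S : comNzRingType) N (T : nzRingType)
    (f g : {rmorphism {mpoly S[N]} -> T}) :
  (forall c, f c%:MP = g c%:MP) -> (forall i, f 'X_i = g 'X_i) -> f =1 g.
Proof.
move=> fC fX; apply: mpoly_closed_ind => // p q fp fq.
  by rewrite !rmorphD fp fq.
by rewrite !rmorphM fp fq.
Qed.

Section LogBracketTransfer.
Variables (K : fieldType) (m : nat) (mu : 'M[K]_m) (F : fieldType).
Local Notation P := {mpoly K[m]}.
Local Notation "x %:F" := (FracField.tofrac x).
Variables (phi : {rmorphism {fraction P} -> F}) (br : F -> F -> F).
Hypothesis brDr : forall a b c, br a (b + c) = br a b + br a c.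
Hypothesis brMr : forall a b c, br a (b * c) = br a b * c + b * br a c.
Hypothesis brN : forall a b, br b a = - br a b.
Hypothesis brC : forall a c, br a (phi (rat_const K m c)) = 0.
Hypothesis brX : forall i j,
  br (phi ('X_i)%:F) (phi ('X_j)%:F) = phi (mu i j *: ('X_i * 'X_j))%:F.
Hypothesis mu_skew : mu^T = - mu.

(** Both sides are derivations along [phi] in [p]; they kill constants by [brC] and agree on the
    variables. *)
Let chain_rule a p :
  br a (phi p%:F) = \sum_i phi (mderiv i p)%:F * br a (phi ('X_i)%:F).
Proof.
have br0 : br a 0 = 0 by apply: (addrI (br a 0)); rewrite -brDr !addr0.
pose E q := br a (phi q%:F) =
  \sum_i phi (mderiv i q)%:F * br a (phi ('X_i)%:F).
rewrite -/(E p).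
have EC c : E c%:MP.
  rewrite /E brC big1 // => i _.
  by rewrite mderivC tofrac0 rmorph0 mul0r.
have ED f g : E f -> E g -> E (f + g).
  rewrite /E tofracD rmorphD brDr => -> ->; rewrite -big_split; apply: eq_bigr => i _ /=.
  by rewrite mderivD tofracD rmorphD mulrDl.
have EM f g : E f -> E g -> E (f * g).
  rewrite /E tofracM rmorphM brMr => -> ->.
  rewrite mulr_suml mulr_sumr -big_split; apply: eq_bigr => i _ /=.
  by rewrite mderivM tofracD !tofracM rmorphD !rmorphM; ring.
have EX i : E 'X_i.
  rewrite /E (bigD1 i) //= mderiv_var eqxx tofrac1 rmorph1 mul1r big1 ?addr0 //.
  by move=> j /negPf ji; rewrite mderiv_var ji tofrac0 rmorph0 mul0r.
exact: mpoly_closed_ind.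
Qed.

Let log_bracketMr f g h : log_bracket mu f (g * h) =
  log_bracket mu f g * h + g * log_bracket mu f h.
Proof. exact: mpoly_bracketMr. Qed.

Let log_bracketN f g : log_bracket mu g f = - log_bracket mu f g.
Proof.
apply: mpoly_bracketN => s t.
have /matrixP /(_ t s) := mu_skew; rewrite !mxE => ->.
by rewrite scaleNr mulrC.
Qed.

Let transfer_poly p q :
  phi (frac_bracket (log_bracket mu) p%:F q%:F) = br (phi p%:F) (phi q%:F).
Proof.
have lMl a b c : log_bracket mu (a * b) c =
    log_bracket mu a c * b + a * log_bracket mu b c.
  by rewrite log_bracketN log_bracketMr opprD -mulNr -mulrN -!log_bracketN.
rewrite (frac_bracket_tofrac lMl log_bracketMr) chain_rule.
under eq_bigr => j _ do rewrite brN chain_rule -sumrN mulr_sumr.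
rewrite exchange_big /log_bracket /mpoly_bracket ![in LHS]rmorph_sum.
apply: eq_bigr => i _; rewrite ![in LHS]rmorph_sum /=; apply: eq_bigr => j _.
by rewrite !tofracM !rmorphM [br _ _]brN brX; ring.
Qed.

Lemma log_bracket_transfer u v :
  phi (frac_bracket (log_bracket mu) u v) = br (phi u) (phi v).
Proof.
have lDr a : {morph log_bracket mu a : b c / b + c} by exact: mpoly_bracketDr.
(* The Leibniz rule applied to (a / b) * b = a determines a derivation along [phi] at a / b from its
   values at a and b. It is used below once in each argument of the bracket. *)
have ext (d e : {fraction P} -> F) :
    (forall x y, d (x * y) = d x * phi y + phi x * d y) ->
    (forall x y, e (x * y) = e x * phi y + phi x * e y) ->
    (forall p, d p%:F = e p%:F) -> forall x, d x = e x.
  move=> dM eM de x.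
  move: (tofrac_repr x) (denom_ratioP (repr x)).
  move: (\n_(repr x)) (\d_(repr x)) => a b -> b0.
  have b1 : phi b%:F != 0 by rewrite fmorph_eq0 tofrac_eq0.
  have aE : a%:F / b%:F * b%:F = a%:F by rewrite divfK ?tofrac_eq0.
  have := congr1 e aE; have := congr1 d aE.
  by rewrite dM eM !de => <- /addIr /(mulIf b1).
have brMl a b c : br (a * b) c = br a c * b + a * br b c.
  by rewrite brN brMr opprD -mulNr -mulrN -!brN.
have fMr := frac_bracketMr log_bracketMr log_bracketN.
have fMl a b c : frac_bracket (log_bracket mu) (a * b) c =
    frac_bracket (log_bracket mu) a c * b + a * frac_bracket (log_bracket mu) b c.
  have fN := frac_bracketN log_bracketMr log_bracketN.
  by rewrite [LHS]fN (fN c a) (fN c b) fMr opprD mulNr mulrN.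
apply: (ext (fun x => phi (frac_bracket _ x v)) (fun x => br (phi x) (phi v))).
- by move=> x y; rewrite fMl rmorphD !rmorphM.
- by move=> x y; rewrite rmorphM brMl.
move=> p; apply: (ext (fun y => phi (frac_bracket _ p%:F y)) (fun y => br (phi p%:F) (phi y))).
- by move=> x y; rewrite fMr rmorphD !rmorphM.
- by move=> x y; rewrite rmorphM brMr.
exact: transfer_poly.
Qed.

End LogBracketTransfer.

(** * Exchanging a row between two minors *)

Section RowSwap.
Variables (R : comNzRingType) (n r r' : nat) (X : 'M[R]_n).
Variables (f g : 'I_r -> 'I_n) (f' g' : 'I_r' -> 'I_n).

(* The product of the two minors after the row [f i] of the first has been
   exchanged with the row [f' i'] of the second. *)
Definition row_swap (i : 'I_r) (i' : 'I_r') : R :=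
  (\sum_j X (f' i') (g j) * cofactor (mxsub f g X) i j) *
  (\sum_j X (f i) (g' j) * cofactor (mxsub f' g' X) i' j).

(** The sum is the minor with row [i] overwritten by row [a]: it has a repeated row unless a = i.
    This is an entry of the product of the matrix with its adjugate. *)
Lemma cofactor_row_subst d (h k : 'I_d -> 'I_n) a i :
  \sum_j X (h a) (k j) * cofactor (mxsub h k X) i j =
  \det (mxsub h k X) *+ (a == i).
Proof.
have -> : \sum_j X (h a) (k j) * cofactor (mxsub h k X) i j =
    (mxsub h k X *m \adj (mxsub h k X)) a i.
  by rewrite mxE; apply: eq_bigr => j _; rewrite !mxE.
by rewrite mul_mx_adj !mxE.
Qed.

Local Notation DD :=
  (\det (mxsub f g X) * \det (mxsub f' g' X)).

Lemma row_swap_eq i i' : f i = f' i' -> row_swap i i' = DD.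
Proof. by move=> E; rewrite /row_swap E -{1}E !cofactor_row_subst !eqxx. Qed.

(** After the exchange one of the two minors contains the same row twice. *)
Lemma row_swap_mem i i' : f i != f' i' ->
  (exists a, f' i' = f a) \/ (exists a, f i = f' a) -> row_swap i i' = 0.
Proof.
move=> ne [[a E]|[a E]]; rewrite /row_swap E cofactor_row_subst.
  have /negPf -> : a != i by apply: contraNneq ne => <-; rewrite E.
  by rewrite mulr0n mul0r.
have /negPf -> : a != i' by apply: contraNneq ne => <-; rewrite E.
by rewrite mulr0n mulr0.
Qed.

(** Exchanges of equal rows have weight 0 but contribute [DD] each to the unweighted sum, whence the
    correction. Any other exchange either vanishes or has weight [e]. *)
Lemma row_swap_sum (s : 'I_n -> 'I_n -> R) (e : R) :
  (forall x, s x x = 0) ->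
  (forall i i', (forall a, f' i' != f a) -> (forall a, f i != f' a) ->
     s (f i) (f' i') = e) ->
  \sum_i \sum_i' s (f i) (f' i') * row_swap i i' =
  e * (\sum_i \sum_i' row_swap i i' - DD *+ \sum_i \sum_i' (f i == f' i')).
Proof.
move=> s0 se; rewrite -sumrMnr -sumrB mulr_sumr; apply: eq_bigr => i _.
rewrite -sumrMnr -sumrB mulr_sumr; apply: eq_bigr => i' _.
have [E|ne] := eqVneq (f i) (f' i').
  by rewrite row_swap_eq // E s0 subrr mul0r mulr0.
rewrite mulr0n subr0.
have [h|h1] := pselect (exists a, f' i' = f a).
  by rewrite row_swap_mem ?mulr0 //; left.
have [h|h2] := pselect (exists a, f i = f' a).
  by rewrite row_swap_mem ?mulr0 //; right.
congr (_ * _); apply: se => a; apply/eqP => E.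
  by apply: h1; exists a.
by apply: h2; exists a.
Qed.

(** With nested rows no exchange can bring a new row to both minors, so only coincidences of rows
    contribute. *)
Lemma row_swap_nested :
  (forall i, exists a, f i = f' a) \/ (forall i', exists a, f' i' = f a) ->
  \sum_i \sum_i' row_swap i i' = DD *+ \sum_i \sum_i' (f i == f' i').
Proof.
move=> nest; rewrite -sumrMnr; apply: eq_bigr => i _.
rewrite -sumrMnr; apply: eq_bigr => i' _.
have [E|ne] := eqVneq (f i) (f' i'); first exact: row_swap_eq.
by apply: row_swap_mem => //; case: nest => h; [right|left].
Qed.

End RowSwap.

(** * The bracket of two minors *)

Section MinorBracket.
Variables (K : fieldType) (n : nat).
Local Notation A := {mpoly K[n * n]}.
Local Notation X := (Xmat K n).
Variables (r r' : nat) (f g : 'I_r -> 'I_n) (f' g' : 'I_r' -> 'I_n).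

(** Both minors are expanded by [det_derivation]. The bracket of two entries exchanges their rows
    (equivalently their columns), and each factor is grouped with the cofactor whose column it
    shares. *)
Lemma mat_bracket_minors :
  let cof i j := cofactor (mxsub f g X) i j in
  let cof' i j := cofactor (mxsub f' g' X) i j in
  mat_bracket (\det (mxsub f g X)) (\det (mxsub f' g' X)) =
  - \sum_i \sum_j \sum_i' \sum_j'
     (nat_sg K n (f i) (f' i') + nat_sg K n (g j) (g' j')) *
     (X (f' i') (g j) * cof i j * (X (f i) (g' j') * cof' i' j')).
Proof.
move=> cof cof'.
have D1 (p : A) : mat_bracket p (\det (mxsub f' g' X)) =
    \sum_i \sum_j mat_bracket p (X (f' i) (g' j)) * cof' i j.
  rewrite (@det_derivation _ _ _ (mat_bracket p)); last 2 first.
  - exact: mpoly_bracketDr.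
  - exact: mpoly_bracketMr.
  by apply: eq_bigr => i _; apply: eq_bigr => j _; rewrite !mxE.
have D2 (p : A) : mat_bracket (\det (mxsub f g X)) p =
    \sum_i \sum_j mat_bracket (X (f i) (g j)) p * cof i j.
  rewrite mat_bracketN (@det_derivation _ _ _ (mat_bracket p)); last 2 first.
  - exact: mpoly_bracketDr.
  - exact: mpoly_bracketMr.
  rewrite -sumrN; apply: eq_bigr => i _; rewrite -sumrN; apply: eq_bigr => j _.
  by rewrite [in RHS]mat_bracketN mulNr; congr (- (mat_bracket _ _ * _)); rewrite !mxE.
rewrite D2 -sumrN; apply: eq_bigr => i _; rewrite -sumrN; apply: eq_bigr => j _.
rewrite D1 mulr_suml -sumrN; apply: eq_bigr => i' _.
rewrite mulr_suml -sumrN; apply: eq_bigr => j' _.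
by rewrite mat_bracketX mat_bracket_genE; ring.
Qed.

Local Notation rsw := (row_swap X f g f' g').
Local Notation csw := (row_swap X^T g f g' f').
(** One term with two readings: summed over [j] and [j'] it is a row exchange; summed over [i] and
    [i'], with the two entries of [X] trading places, it is a column exchange. *)
Let T i j i' j' := X (f' i') (g j) * cofactor (mxsub f g X) i j *
  (X (f i) (g' j') * cofactor (mxsub f' g' X) i' j').

Let row_swapE i i' : rsw i i' = \sum_j \sum_j' T i j i' j'.
Proof. by rewrite /row_swap mulr_suml; apply: eq_bigr => j _; rewrite mulr_sumr. Qed.

Let col_swapE j j' : csw j j' = \sum_i \sum_i' T i j i' j'.
Proof.
have cofT d (h k : 'I_d -> 'I_n) a b :
    cofactor (mxsub k h X^T) b a = cofactor (mxsub h k X) a b.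
  rewrite /cofactor addnC -det_tr; congr (_ * \det _).
  by apply/matrixP => c e; rewrite !mxE.
rewrite /row_swap mulr_suml; apply: eq_bigr => i _.
rewrite mulr_sumr; apply: eq_bigr => i' _.
by rewrite /T !cofT ![X^T _ _]mxE; ring.
Qed.

Let sum4_exchange (F : 'I_r -> 'I_r -> 'I_r' -> 'I_r' -> A) :
  \sum_i \sum_j \sum_i' \sum_j' F i j i' j' =
  \sum_j \sum_j' \sum_i \sum_i' F i j i' j'.
Proof.
rewrite exchange_big; apply: eq_bigr => j _.
transitivity (\sum_i \sum_j' \sum_i' F i j i' j'); last exact: exchange_big.
by apply: eq_bigr => i _; exact: exchange_big.
Qed.

Lemma mat_bracket_swaps :
  mat_bracket (\det (mxsub f g X)) (\det (mxsub f' g' X)) =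
  - (\sum_i \sum_i' nat_sg K n (f i) (f' i') * rsw i i' +
     \sum_j \sum_j' nat_sg K n (g j) (g' j') * csw j j').
Proof.
rewrite mat_bracket_minors; congr (- _).
transitivity (\sum_i \sum_j \sum_i' \sum_j' nat_sg K n (f i) (f' i') * T i j i' j' +
  \sum_i \sum_j \sum_i' \sum_j' nat_sg K n (g j) (g' j') * T i j i' j').
  rewrite -big_split; apply: eq_bigr => i _; rewrite -big_split; apply: eq_bigr => j _.
  rewrite -big_split; apply: eq_bigr => i' _; rewrite -big_split; apply: eq_bigr => j' _.
  exact: mulrDl.
congr (_ + _).
  apply: eq_bigr => i _; rewrite exchange_big; apply: eq_bigr => i' _.
  by rewrite row_swapE mulr_sumr; apply: eq_bigr => j _; rewrite mulr_sumr.
rewrite sum4_exchange; apply: eq_bigr => j _; apply: eq_bigr => j' _.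
by rewrite col_swapE mulr_sumr; apply: eq_bigr => i _; rewrite mulr_sumr.
Qed.

(* The split Casimir element acts in the same way through rows and columns. *)
Lemma sum_row_swap_col_swap :
  \sum_i \sum_i' rsw i i' = \sum_j \sum_j' csw j j'.
Proof.
transitivity (\sum_i \sum_j \sum_i' \sum_j' T i j i' j').
  apply: eq_bigr => i _; rewrite [RHS]exchange_big; apply: eq_bigr => i' _.
  exact: row_swapE.
rewrite sum4_exchange; apply: eq_bigr => j _; apply: eq_bigr => j' _.
by rewrite col_swapE.
Qed.

Lemma minors_log_canonical (e1 e2 : bool) :
    (forall i i', (forall a, f' i' != f a) -> (forall a, f i != f' a) ->
       nat_sg K n (f i) (f' i') = (-1) ^+ e1) ->
    (forall j j', (forall b, g' j' != g b) -> (forall b, g j != g' b) ->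
       nat_sg K n (g j) (g' j') = (-1) ^+ e2) ->
    [\/ (forall i, exists a, f i = f' a) \/ (forall i', exists a, f' i' = f a),
        (forall j, exists b, g j = g' b) \/ (forall j', exists b, g' j' = g b)
      | e1 != e2] ->
  exists c : K, mat_bracket (\det (mxsub f g X)) (\det (mxsub f' g' X)) =
    c *: (\det (mxsub f g X) * \det (mxsub f' g' X)).
Proof.
move=> se1 se2 cond.
have sg0 x : nat_sg K n x x = 0 by rewrite /nat_sg ltnn.
have dT d (h k : 'I_d -> 'I_n) : \det (mxsub k h X^T) = \det (mxsub h k X).
  by rewrite -det_tr; congr (\det _); apply/matrixP => a b; rewrite !mxE.
pose sg (x y : 'I_n) := nat_sg K n x y.
have rE := row_swap_sum X (f := f) g (f' := f') g' (s := sg) (fun x => sg0 x) se1.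
have cE := row_swap_sum X^T (f := g) f (f' := g') f' (s := sg) (fun x => sg0 x) se2.
have rN := row_swap_nested X (f := f) g (f' := f') g'.
have cN := row_swap_nested X^T (f := g) f (f' := g') f'.
rewrite !dT -sum_row_swap_col_swap in cE cN.
have -> := etrans mat_bracket_swaps (congr1 -%R (congr2 +%R rE cE)).
move: rN cN; clear rE cE.
move: (\sum_i \sum_i' rsw i i') (\det _ * \det _) => S D.
(* [t1] and [t2] count the coincidences of rows and of columns. The bracket is now minus the sum of
   e (S - t1 D) and e' (S - t2 D), for the signs e and e' given by [e1] and [e2]. *)
move: (\sum_i \sum_i' (f i == f' i') : nat)%N (\sum_j \sum_j' (g j == g' j') : nat)%N => t1 t2.
move=> rN cN.
have nested (s : nat) : S = D *+ s -> exists c : K,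
    - ((-1) ^+ e1 * (S - D *+ t1) + (-1) ^+ e2 * (S - D *+ t2)) = c *: D.
  move=> ->.
  exists (- ((-1) ^+ e1 * (s%:R - t1%:R) + (-1) ^+ e2 * (s%:R - t2%:R))).
  rewrite -mul_mpolyC !(rmorphN, rmorphD, rmorphM, rmorphXn, rmorph1, rmorph_nat) /=.
  rewrite -(mulr_natl D s) -(mulr_natl D t1) -(mulr_natl D t2); ring.
case: cond => [/rN|/cN|]; [exact: nested|exact: nested|move=> e12].
(* With opposite signs the two occurrences of [S] cancel and only the corrections remain. *)
exists ((-1) ^+ e1 * (t1%:R - t2%:R)).
have -> : (-1) ^+ e2 = - (-1) ^+ e1 :> A.
  by case: e1 e2 e12 {nested se1 se2} => -[] //=; rewrite ?expr1 ?opprK.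
rewrite -mul_mpolyC !(rmorphN, rmorphD, rmorphM, rmorphXn, rmorph1, rmorph_nat) /=.
rewrite -(mulr_natl D t1) -(mulr_natl D t2); ring.
Qed.

End MinorBracket.

(** * Initial minors and their brackets *)

Section InitialMinors.
Variable n : nat.

(* The interval of length [r] ending at [i]; only meaningful for [r <= i.+1]. *)
Definition ord_itv (r : nat) (i : 'I_n) (a : 'I_r) : 'I_n :=
  insubd i (i.+1 - r + a)%N.

Lemma val_ord_itv r (i : 'I_n) (a : 'I_r) : (r <= i.+1)%N ->
  ord_itv i a = (i.+1 - r + a)%N :> nat.
Proof.
move=> ri; rewrite /ord_itv val_insubd; case: ifP => //.
by have := ltn_ord i; have := ltn_ord a; lia.
Qed.

Lemma ord_itv_max r (i : 'I_n) : (r <= i)%N -> ord_itv i (ord_max : 'I_r.+1) = i.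
Proof. by move=> ri; apply: val_inj; rewrite /= val_ord_itv //=; lia. Qed.

Lemma ord_itv_mem r (i x : 'I_n) : (r <= i.+1)%N ->
  (i.+1 - r <= x <= i)%N -> exists a : 'I_r, x = ord_itv i a.
Proof.
move=> ri xi; have xr : (x - (i.+1 - r) < r)%N by lia.
exists (Ordinal xr); apply: val_inj; rewrite /= val_ord_itv //=; lia.
Qed.

Lemma ord_itv_sub r r' (i i' : 'I_n) : (r <= i.+1)%N -> (r' <= i'.+1)%N ->
  (i <= i')%N -> (i'.+1 - r' <= i.+1 - r)%N ->
  forall a : 'I_r, exists b : 'I_r', ord_itv i a = ord_itv i' b.
Proof.
move=> ri ri' ii oo a; apply: ord_itv_mem => //.
by rewrite val_ord_itv //; have := ltn_ord a; lia.
Qed.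

(** If neither interval contains the other, one is shifted past the other, and the indices proper to
    one lie all on the same side of those proper to the other. If one contains the other, the two
    exclusion hypotheses are contradictory, so the sign stated there is immaterial. *)
Lemma ord_itv_sg (K : fieldType) r r' (i i' : 'I_n) (a : 'I_r) (a' : 'I_r') :
  (r <= i.+1)%N -> (r' <= i'.+1)%N ->
  (forall b : 'I_r, ord_itv i' a' != ord_itv i b) ->
  (forall b : 'I_r', ord_itv i a != ord_itv i' b) ->
  nat_sg K n (ord_itv i a) (ord_itv i' a') =
    (-1) ^+ ((i <= i')%N && (i.+1 - r <= i'.+1 - r')%N).
Proof.
move=> ri ri' n1 n2.
have h1 : ~~ (i.+1 - r <= ord_itv i' a' <= i)%N.
  by apply/negP => /(ord_itv_mem ri) [b /eqP]; apply/negP.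
have h2 : ~~ (i'.+1 - r' <= ord_itv i a <= i')%N.
  by apply/negP => /(ord_itv_mem ri') [b /eqP]; apply/negP.
have la := ltn_ord a; have la' := ltn_ord a'.
move: h1 h2; rewrite !val_ord_itv // /nat_sg => h1 h2.
case: ifP => l1.
  by have -> : (i <= i')%N && (i.+1 - r <= i'.+1 - r')%N = false by lia.
have -> : (i.+1 - r + a < i'.+1 - r' + a')%N by lia.
by have -> : (i <= i')%N && (i.+1 - r <= i'.+1 - r')%N by lia.
Qed.

Definition initial_minor (R : comNzRingType) (M : 'M[R]_n) (p : 'I_n * 'I_n) : R :=
  \det (mxsub (@ord_itv (minn p.1 p.2).+1 p.1) (@ord_itv (minn p.1 p.2).+1 p.2) M).

Lemma initial_minor_map (R S : comNzRingType) (f : {rmorphism R -> S}) (M : 'M[R]_n) p :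
  initial_minor (map_mx f M) p = f (initial_minor M p).
Proof. by rewrite /initial_minor -det_map_mx map_mxsub. Qed.

Lemma initial_minors_log_canonical (K : fieldType) p q :
  exists c : K, mat_bracket (initial_minor (Xmat K n) p) (initial_minor (Xmat K n) q) =
    c *: (initial_minor (Xmat K n) p * initial_minor (Xmat K n) q).
Proof.
case: p q => [i j] [i' j']; rewrite /initial_minor /=.
set r := (minn i j).+1; set r' := (minn i' j').+1.
have [ri rj] : (r <= i.+1)%N /\ (r <= j.+1)%N by rewrite /r; lia.
have [ri' rj'] : (r' <= i'.+1)%N /\ (r' <= j'.+1)%N by rewrite /r'; lia.
apply: minors_log_canonical.
- by move=> a a' n1 n2; exact: ord_itv_sg.
- by move=> b b' n1 n2; exact: ord_itv_sg.
have [|h1] := boolP ((i <= i')%N && (i'.+1 - r' <= i.+1 - r)%N).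
  by case/andP=> *; apply: Or31; left; exact: ord_itv_sub.
have [|h2] := boolP ((i' <= i)%N && (i.+1 - r <= i'.+1 - r')%N).
  by case/andP=> *; apply: Or31; right; exact: ord_itv_sub.
have [|h3] := boolP ((j <= j')%N && (j'.+1 - r' <= j.+1 - r)%N).
  by case/andP=> *; apply: Or32; left; exact: ord_itv_sub.
have [|h4] := boolP ((j' <= j)%N && (j.+1 - r <= j'.+1 - r')%N).
  by case/andP=> *; apply: Or32; right; exact: ord_itv_sub.
(* Without nesting, one minor starts in the first row and the other in the first column. The former
   comes first in the order of rows and last in the order of columns, so the signs differ. *)
apply: Or33; rewrite /r /r' in h1 h2 h3 h4 *; lia.
Qed.

End InitialMinors.

(** * The determinant as an affine function of its corner entry *)

Section Corner.
Variables (R : comNzRingType) (r : nat).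
Local Notation corner_lift := (widen_ord (leqnSn r)).

Definition corner_minor (N : 'M[R]_r.+1) : R := \det (mxsub corner_lift corner_lift N).

Definition corner_set (x : R) (N : 'M[R]_r.+1) : 'M[R]_r.+1 :=
  \matrix_(a, b) if (a == ord_max) && (b == ord_max) then x else N a b.

(** Expand along the last row: its cofactors do not involve the corner entry, and the cofactor of
    the corner has sign +1. *)
Lemma det_corner_set x (N : 'M[R]_r.+1) :
  \det (corner_set x N) = x * corner_minor N + \det (corner_set 0 N).
Proof.
have cofE y (j : 'I_r.+1) : cofactor (corner_set y N) ord_max j = cofactor N ord_max j.
  rewrite /cofactor; congr (_ * \det _); apply/matrixP => a b; rewrite !mxE.
  by rewrite [_ == ord_max]eq_sym (negPf (neq_lift _ _)).
rewrite !(expand_det_row _ ord_max) (bigD1 ord_max) //=.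
rewrite [X in _ = _ + X](bigD1 ord_max) //= !cofE !mxE !eqxx mul0r add0r.
congr (_ * _ + _).
  rewrite /cofactor -signr_odd oddD addbb expr0 mul1r; congr (\det _).
  apply/matrixP => a b; rewrite !mxE; congr (N _ _); apply: val_inj;
    by rewrite /= /bump leqNgt ltn_ord.
by apply: eq_bigr => j /negPf jm; rewrite !cofE !mxE jm andbF.
Qed.

Lemma corner_set_id (N : 'M[R]_r.+1) : corner_set (N ord_max ord_max) N = N.
Proof. by apply/matrixP => a b; rewrite mxE; case: andP => [[/eqP-> /eqP->]|]. Qed.

End Corner.

Section Image.
Variables (F1 F2 : fieldType) (phi : {rmorphism F1 -> F2}).
Local Notation im x := (exists u, phi u = x).

Lemma det_image r (N : 'M[F2]_r) : (forall a b, im (N a b)) -> im (\det N).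
Proof.
move=> imN; exists (\det (\matrix_(a, b) sval (cid (imN a b)))).
rewrite -det_map_mx; congr (\det _); apply/matrixP => a b; rewrite !mxE.
by case: cid.
Qed.

(** The image of [phi] is a subfield, in which the affine relation of [det_corner_set] can be solved
    for the corner entry. *)
Lemma corner_image r (N : 'M[F2]_r.+1) :
  (forall a b, (a != ord_max) || (b != ord_max) -> im (N a b)) ->
  im (\det N) -> corner_minor N != 0 -> im (N ord_max ord_max).
Proof.
move=> imN [d dE] c0.
have [c cE] : im (corner_minor N).
  apply: det_image => a b; rewrite !mxE; apply: imN.
  by rewrite -val_eqE /= neq_ltn ltn_ord.
have [e eE] : im (\det (corner_set 0 N)).
  apply: det_image => a b; rewrite mxE; case: ifP => [_|/negbT].
    by exists 0; rewrite rmorph0.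
  by rewrite negb_and; exact: imN.
exists ((d - e) / c); rewrite fmorph_div rmorphB dE cE eE.
have := det_corner_set (N ord_max ord_max) N; rewrite corner_set_id => ->.
by rewrite addrK mulfK.
Qed.

End Image.

(** * Matrices with prescribed initial minors *)

Section InitialMinorMap.
Variable n : nat.
Implicit Types p q : 'I_n * 'I_n.

Lemma initial_minorE (R : comNzRingType) (M : 'M[R]_n) r (i j : 'I_n) :
  (minn i j).+1 = r -> initial_minor M (i, j) =
    \det (mxsub (@ord_itv n r i) (@ord_itv n r j) M).
Proof. by move=> <-. Qed.

Lemma eq_initial_minor (R : comNzRingType) (M M' : 'M[R]_n) p :
  (forall i j : 'I_n, (i <= p.1)%N -> (j <= p.2)%N -> M i j = M' i j) ->
  initial_minor M p = initial_minor M' p.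
Proof.
move=> E; congr (\det _); apply/matrixP => a b; rewrite !mxE.
by apply: E; rewrite val_ord_itv ?ltnS ?geq_minl ?geq_minr //;
  have := ltn_ord a; have := ltn_ord b; lia.
Qed.

Lemma leading_minor (R : comNzRingType) (M : 'M[R]_n) (i : 'I_n)
    (f g : 'I_i.+1 -> 'I_n) :
  (forall a, f a = a :> nat) -> (forall a, g a = a :> nat) ->
  \det (mxsub f g M) = initial_minor M (i, i).
Proof.
move=> fE gE; rewrite (@initial_minorE _ _ i.+1); last by rewrite minnn.
congr (\det _); apply/matrixP => a b; rewrite !mxE.
by congr (M _ _); apply: val_inj; rewrite /= ?fE ?gE val_ord_itv // subnn.
Qed.

Definition initial_block (R : comNzRingType) (M : 'M[R]_n) p : 'M[R]_((minn p.1 p.2).+1) :=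
  mxsub (@ord_itv n _ p.1) (@ord_itv n _ p.2) M.

Lemma initial_block_max (R : comNzRingType) (M : 'M[R]_n) p :
  initial_block M p ord_max ord_max = M p.1 p.2.
Proof. by rewrite mxE !ord_itv_max ?geq_minl ?geq_minr. Qed.

(** Removing the last row and column keeps contact with the first row or column, so the slope in the
    corner entry is again an initial minor, or the empty determinant. *)
Lemma initial_block_corner (R : comNzRingType) (M : 'M[R]_n) (i j : 'I_n) :
  corner_minor (initial_block M (i, j)) = 1 \/
  exists i' j' : 'I_n, [/\ i = i'.+1 :> nat, j = j'.+1 :> nat
    & corner_minor (initial_block M (i, j)) = initial_minor M (i', j')].
Proof.
rewrite /corner_minor /initial_block /=.
have [r0|r_gt0] := posnP (minn i j).
  left; move: (widen_ord _) (ord_itv _) (ord_itv _); rewrite r0 => w f g.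
  exact: det_mx00.
right; have i1 : (i.-1 < n)%N by have := ltn_ord i; lia.
have j1 : (j.-1 < n)%N by have := ltn_ord j; lia.
exists (Ordinal i1), (Ordinal j1); split=> /=; [lia|lia|].
rewrite (@initial_minorE _ _ (minn i j)) /=; last by lia.
congr (\det _); apply/matrixP => a b; rewrite !mxE.
congr (M _ _); apply: val_inj; rewrite /= !val_ord_itv ?geq_minl ?geq_minr //=; lia.
Qed.

(** The order in which the entries are solved for: row by row, so that every entry above and to the
    left comes earlier. *)
Definition lex_rank p := (p.1 * n + p.2)%N.

Lemma lex_rank_lt p q : (p.1 <= q.1)%N -> (p.2 <= q.2)%N -> p != q ->
  (lex_rank p < lex_rank q)%N.
Proof.
case: p q => [i j] [i' j'] /= ii jj; rewrite xpair_eqE -!val_eqE /= /lex_rank /= => ne.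
have := ltn_ord i; nia.
Qed.

Lemma lex_rank_inj : injective lex_rank.
Proof.
case=> [i j] [i' j']; rewrite /lex_rank /= => E.
have n0 : (0 < n)%N by have := ltn_ord i; lia.
have ii : i = i' by apply: val_inj; rewrite /=; have := congr1 (divn^~ n) E;
  rewrite !divnMDl // !divn_small ?addn0.
by move: E; rewrite ii => /addnI /val_inj ->.
Qed.

Lemma initial_block_noncorner p a b : 
  (a != ord_max) || (b != ord_max) ->
  (lex_rank (@ord_itv n (minn p.1 p.2).+1 p.1 a,
             @ord_itv n (minn p.1 p.2).+1 p.2 b) < lex_rank p)%N.
Proof.
case: p a b => [i j] a b /= ab.
have := ltn_ord a; have := ltn_ord b; move: ab; rewrite -!val_eqE /= => ab la lb.
have [h1 h2] : ((minn i j).+1 <= i.+1)%N /\ ((minn i j).+1 <= j.+1)%N by lia.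
apply: lex_rank_lt => /=; rewrite ?xpair_eqE -?val_eqE /= ?val_ord_itv //; lia.
Qed.

Lemma exists_initial_minors (F : fieldType) (y : 'I_n * 'I_n -> F) :
  (forall p, y p != 0) -> exists M : 'M[F]_n, forall p, initial_minor M p = y p.
Proof.
move=> y0; suff [M ME] : exists M : 'M[F]_n, forall p,
    (lex_rank p < n * n)%N -> initial_minor M p = y p.
  exists M => p; apply: ME; case: p => i j; rewrite /lex_rank /=.
  by have := ltn_ord i; have := ltn_ord j; nia.
elim: (n * n)%N => [|t [M ME]]; first by exists 0.
have [[p pt]|np] := pselect (exists p, lex_rank p = t); last first.
  exists M => q; rewrite ltnS leq_eqVlt => /predU1P[qt|]; last exact: ME.
  by case: np; exists q.
set N := initial_block M p.
have c0 : corner_minor N != 0.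
  case: p @N pt => i j N pt.
  have [-> |[i' [j' [ii jj ->]]]] := initial_block_corner M i j.
    exact: oner_neq0.
  by rewrite ME // -pt /lex_rank /= ii jj; nia.
(* The root of the affine equation for the entry at [p]; its slope is 1 or an earlier prescribed
   value, hence nonzero. *)
pose x := (y p - \det (corner_set 0 N)) / corner_minor N.
pose M' : 'M[F]_n := \matrix_(i, j) if (i, j) == p then x else M i j.
exists M' => q; rewrite ltnS leq_eqVlt => /predU1P[qt|qt]; last first.
  (* The block of an earlier [q] lies above and to the left of [q], so it does not meet the modified
     cell [p]. *)
  rewrite -(ME _ qt); apply: eq_initial_minor => i j iq jq; rewrite mxE.
  case: eqP => // E; move: qt; rewrite -pt -E.
  have [->|ne] := eqVneq (i, j) q; first by rewrite ltnn.
  by have := lex_rank_lt (p := (i, j)) iq jq ne; lia.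
have -> : q = p by apply: lex_rank_inj; rewrite qt.
have -> : initial_minor M' p = \det (corner_set x N).
  congr (\det _); apply/matrixP => a b; rewrite !mxE.
  case: (boolP (_ && _)) => [/andP[/eqP -> /eqP ->]|].
    by rewrite !ord_itv_max ?geq_minl ?geq_minr // -surjective_pairing eqxx.
  rewrite negb_and => ab; have := initial_block_noncorner ab.
  by case: eqP => // ->; rewrite ltnn.
by rewrite det_corner_set /x divfK // subrK.
Qed.

End InitialMinorMap.

(** * Prescribed initial minors in rank at most k *)

Lemma leading_block (n k : nat) (R : comNzRingType) (M : 'M[R]_n) (f g : 'I_k -> 'I_n) :
  (k <= n)%N -> (forall a, f a = a :> nat) -> (forall a, g a = a :> nat) ->
  \det (mxsub f g M) = 1 \/
  exists i : 'I_n, (i < k)%N /\ \det (mxsub f g M) = initial_minor M (i, i).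
Proof.
case: k f g => [|k] f g kn fE gE; first by left; exact: det_mx00.
right; exists (Ordinal kn); split=> //.
exact: (@leading_minor _ _ _ (Ordinal kn)).
Qed.

Section RankK.
Variables (n k : nat).
Hypothesis k_lt_n : (k < n)%N.

(** It has n^2 - (n - k)^2 cells, the dimension of the variety of matrices of rank at most k. *)
Definition hook : pred ('I_n * 'I_n) := fun p => (p.1 < k)%N || (p.2 < k)%N.

Lemma exists_low_rank_initial_minors (F : fieldType) (y : 'I_n * 'I_n -> F) :
  (forall p, y p != 0) ->
  exists M : 'M[F]_n, (forall f g : 'I_k.+1 -> 'I_n, \det (mxsub f g M) = 0) /\
    forall p, hook p -> initial_minor M p = y p.
Proof.
move=> /[dup] y0 /exists_initial_minors [M ME].
pose w : 'I_k -> 'I_n := widen_ord (ltnW k_lt_n).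
have Aunit : mxsub w w M \in unitmx.
  rewrite unitmxE unitfE.
  have [||->|[i [_ ->]]] // := @leading_block n k _ M w w (ltnW k_lt_n).
    exact: oner_neq0.
  by rewrite ME.
(* Skeleton decomposition: [M'] factors through dimension k, hence has no nonzero minor of size k +
   1, and it agrees with [M] on the first k rows and columns. Initial minors at cells of the hook
   see no other entries. *)
pose C := colsub w M *m invmx (mxsub w w M).
pose M' := C *m rowsub w M.
have M'r (a : 'I_k) j : M' (w a) j = M (w a) j.
  transitivity ((rowsub w C *m rowsub w M) a j).
    by rewrite !mxE; apply: eq_bigr => b _; rewrite !mxE.
  rewrite -mul_rowsub_mx (_ : rowsub w (colsub w M) = mxsub w w M).
    by rewrite mulmxV // mul1mx mxE.
  by apply/matrixP => a' b'; rewrite !mxE.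
have M'c i (b : 'I_k) : M' i (w b) = M i (w b).
  transitivity ((C *m mxsub w w M) i b).
    by rewrite !mxE; apply: eq_bigr => a _; rewrite !mxE.
  by rewrite /C mulmxKV // mxE.
exists M'; split=> [f g|p hp].
  have -> : mxsub f g M' = rowsub f C *m colsub g (rowsub w M).
    by apply/matrixP => a b; rewrite !mxE; apply: eq_bigr => c _; rewrite !mxE.
  apply/eqP/negPn/negP => d0.
  have : \rank (rowsub f C *m colsub g (rowsub w M)) = k.+1.
    by apply: mxrank_unit; rewrite unitmxE unitfE.
  have := mxrankM_maxl (rowsub f C) (colsub g (rowsub w M)).
  have := rank_leq_col (rowsub f C); lia.
rewrite -ME; apply: eq_initial_minor => i j ip jp.
case/orP: hp => hp.
  have ik : (i < k)%N by lia.
  have -> : i = w (Ordinal ik) by apply: val_inj.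
  exact: M'r.
have jk : (j < k)%N by lia.
have -> : j = w (Ordinal jk) by apply: val_inj.
exact: M'c.
Qed.

End RankK.

(** * The quotient map onto the determinantal ring *)

Section DetProjection.
Variables (K : fieldType) (n k : nat).
Local Notation A := {mpoly K[n * n]}.
Local Notation R := (det_ring K n k).

(** Named separately so that the quotient map carries a ring morphism structure with the integral
    domain [det_ring] as its target. *)
Definition det_proj (p : A) : R := \pi_R p.

Lemma det_proj_zmod : zmod_morphism det_proj.
Proof.
exact: (raddfB (\pi_{ideal_quot (det_ideal K n k)})).
Qed.

Lemma det_proj_monoid : monoid_morphism det_proj.
Proof.
split=> [|p q]; first exact: (rmorph1 (\pi_{ideal_quot (det_ideal K n k)})).
exact: (rmorphM (\pi_{ideal_quot (det_ideal K n k)})).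
Qed.

HB.instance Definition _ := GRing.isZmodMorphism.Build A R det_proj det_proj_zmod.
HB.instance Definition _ := GRing.isMonoidMorphism.Build A R det_proj det_proj_monoid.

Lemma det_proj_eq0 p : (det_proj p == 0) = (p \in det_ideal K n k).
Proof.
rewrite -(rmorph0 det_proj) -[RHS]/(p \in (det_ideal K n k : idealr _)).
by rewrite -[in RHS](subr0 p) Quotient.idealrBE.
Qed.

Lemma det_proj_surj (x : R) : exists p, det_proj p = x.
Proof. by exists (repr x); rewrite /det_proj reprK. Qed.

Lemma det_bracket_proj p q :
  det_bracket K n k (det_proj p) (det_proj q) = det_proj (mat_bracket p q).
Proof. exact: det_bracketE. Qed.

Lemma det_bracketDr (u v w : R) :
  det_bracket K n k u (v + w) = det_bracket K n k u v + det_bracket K n k u w.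
Proof.
have [[p <-] [q <-] [r <-]] := And3 (det_proj_surj u) (det_proj_surj v) (det_proj_surj w).
rewrite -rmorphD !det_bracket_proj -rmorphD; congr det_proj.
exact: mpoly_bracketDr.
Qed.

End DetProjection.

(** * Initial minors as free generators of the field of fractions *)

Section InitialCoordinates.
Variables (K : fieldType) (n k : nat).
Hypothesis k_lt_n : (k < n)%N.
Local Notation A := {mpoly K[n * n]}.
Local Notation R := (det_ring K n k).
Local Notation X := (Xmat K n).
Local Notation m := #|@hook n k|.
Local Notation P := {mpoly K[m]}.
Local Notation cell := (fun t : 'I_m => enum_val t : 'I_n * 'I_n).
Local Notation D := (fun t : 'I_m => initial_minor X (cell t)).
Local Notation "x %:F" := (FracField.tofrac x).

Definition hook_eval : P -> A := mmap (@mpolyC (n * n) K) D.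
HB.instance Definition _ := GRing.RMorphism.on hook_eval.

Lemma hook_evalC c : hook_eval c%:MP = c%:MP.
Proof. exact: mmapC. Qed.

Lemma hook_evalX t : hook_eval 'X_t = D t.
Proof. by rewrite /hook_eval mmapX mmap1U. Qed.

(** Algebraic independence modulo the ideal: specialise [X] to a matrix of rank at most k over the
    rational functions whose initial minors on the hook are the variables. This kills the ideal and
    sends [hook_eval p] to [p]. *)
Lemma hook_eval_det_ideal p : hook_eval p \in det_ideal K n k -> p = 0.
Proof.
(* The value 1 off the hook serves only to be nonzero. *)
have y0 (q : 'I_n * 'I_n) : 
    (if [pick t | cell t == q] is Some t then ('X_t : P)%:F else 1) != 0.
  case: pickP => [t _|_]; last exact: oner_neq0.
  by rewrite tofrac_eq0 -msupp_eq0 msuppX.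
have [M [Mdet ME]] := exists_low_rank_initial_minors k_lt_n y0.
pose h s := M (rowi s) (coli s).
pose theta : {rmorphism A -> {fraction P}} := mmap (@FracField.tofrac P \o @mpolyC m K) h.
have thetaX : map_mx theta X = M.
  apply/matrixP => i j; rewrite !mxE /theta /= mmapX mmap1U.
  by rewrite /h rowiE coliE.
have theta_ideal q : q \in det_ideal K n k -> theta q = 0.
  move=> /asboolP[s sP ->]; rewrite rmorph_sum big_seq big1 // => c /sP[f [g [_ _ E]]].
  by rewrite rmorphM /= E -det_map_mx map_mxsub thetaX Mdet mulr0.
have thetaK q : theta (hook_eval q) = q%:F.
  apply: (rmorph_mpoly_ext (f := theta \o hook_eval) (g := @FracField.tofrac P)) => [c|t] /=.
    by rewrite hook_evalC [LHS]mmapC.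
  rewrite hook_evalX -initial_minor_map thetaX ME; last exact: (enum_valP t).
  case: pickP => [t' /eqP /enum_val_inj -> //|/(_ t)].
  by rewrite eqxx.
by move=> /theta_ideal; rewrite thetaK => /eqP; rewrite tofrac_eq0 => /eqP.
Qed.

Lemma hook_frac_map : exists2 phi : {rmorphism {fraction P} -> {fraction R}},
  (forall p, phi p%:F = (det_proj k (hook_eval p))%:F) & forall y, exists x, phi x = y.
Proof.
pose f : {rmorphism P -> {fraction R}} :=
  @FracField.tofrac R \o (@det_proj K n k \o hook_eval).
have f_inj : injective f.
  apply: raddf_inj => p /eqP; rewrite /= tofrac_eq0 det_proj_eq0.
  exact: hook_eval_det_ideal.
have [phi phiE] := frac_extension f_inj; exists phi => //.
pose g : {rmorphism A -> {fraction R}} := @FracField.tofrac R \o @det_proj K n k.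
have phiX q : hook k q -> exists2 x, x != 0 & phi x = initial_minor (map_mx g X) q.
  move=> hq; exists ('X_(enum_rank_in hq q))%:F.
    by rewrite tofrac_eq0 -msupp_eq0 msuppX.
  by rewrite phiE /= hook_evalX enum_rankK_in // initial_minor_map.
have g_ne0 q : hook k q -> initial_minor (map_mx g X) q != 0.
  by move=> /phiX [x x0 <-]; rewrite fmorph_eq0.
(* Induction on the rank of the cell. On the hook, the entry is the corner of its initial block,
   whose determinant lies in the image and whose slope is nonzero. *)
have imX q : exists x, phi x = map_mx g X q.1 q.2.
  have [w] := ubnP (lex_rank q); elim: w q => // w IH q /ltnSE le_w.
  have [hq|nq] := boolP (hook k q).
    rewrite -initial_block_max; apply: corner_image => [a b ab||].
    - rewrite mxE; apply: (IH (_, _)); apply: leq_trans le_w.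
      exact: initial_block_noncorner.
    - by have [x _ xE] := phiX q hq; exists x.
    case: q hq {le_w} => i j hq.
    have [-> |[i' [j' [ii jj ->]]]] := initial_block_corner (map_mx g X) i j.
      exact: oner_neq0.
    by apply: g_ne0; rewrite /hook /= in hq *; lia.
  have [q1 q2] : (k <= q.1)%N /\ (k <= q.2)%N by rewrite /hook in nq; lia.
  (* Off the hook, border the leading block of size k with row [q.1] and column [q.2]: this minor of
     size k + 1 vanishes, and its slope in the entry at [q] is the leading minor. The default of
     [insubd] never occurs, since a < k < n. *)
  pose ext (i : 'I_n) (a : 'I_k.+1) : 'I_n := if (a < k)%N then insubd i a else i.
  have extE (i : 'I_n) (a : 'I_k.+1) : (k <= i)%N ->
      ext i a = (if a < k then a : nat else i)%N :> nat.
    move=> ki; rewrite /ext; case: ifP => // ak; rewrite val_insubd.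
    by case: ifP => //; have := ltn_ord i; lia.
  have ext_max (i : 'I_n) : ext i ord_max = i by rewrite /ext ltnn.
  pose N := mxsub (ext q.1) (ext q.2) (map_mx g X).
  have -> : map_mx g X q.1 q.2 = N ord_max ord_max by rewrite !mxE !ext_max.
  apply: corner_image => [a b ab||].
  - rewrite mxE; apply: (IH (_, _)); apply: leq_trans le_w.
    move: ab; rewrite -!val_eqE /= => ab; have := ltn_ord a; have := ltn_ord b => lb la.
    apply: lex_rank_lt => /=; rewrite ?extE //; try by case: ifP; lia.
    by rewrite -pair_eqE /= -!val_eqE /= !extE //; case: ifP; case: ifP; lia.
  - exists 0; rewrite rmorph0 /N -map_mxsub det_map_mx /= /g /=.
    apply/esym/eqP; rewrite tofrac_eq0 det_proj_eq0; exact: det_ideal_mxsub.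
  have -> : corner_minor N =
      \det (mxsub (ext q.1 \o widen_ord (leqnSn k)) (ext q.2 \o widen_ord (leqnSn k))
              (map_mx g X)).
    by congr (\det _); apply/matrixP => a b; rewrite !mxE.
  have [a /=|a /=|->|[i [ik ->]]] := leading_block (map_mx g X)
    (f := ext q.1 \o widen_ord (leqnSn k)) (g := ext q.2 \o widen_ord (leqnSn k)) (ltnW k_lt_n).
  - by rewrite extE //= ltn_ord.
  - by rewrite extE //= ltn_ord.
  - exact: oner_neq0.
  by apply: g_ne0; rewrite /hook /= ik.
have img p : exists x, phi x = g p.
  elim/mpoly_closed_ind: p => [c|s|p q [x xE] [y yE]|p q [x xE] [y yE]].
  - by exists (c%:MP)%:F; rewrite phiE /= hook_evalC.
  - have := imX (rowi s, coli s); rewrite !mxE /=.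
    by rewrite index_rowcol.
  - by exists (x + y); rewrite !rmorphD xE yE.
  by exists (x * y); rewrite !rmorphM xE yE.
move=> y; rewrite (tofrac_repr y).
have [a aE] := det_proj_surj (\n_(repr y)); have [b bE] := det_proj_surj (\d_(repr y)).
have [u uE] := img a; have [v vE] := img b.
by exists (u / v); rewrite fmorph_div uE vE /g /= aE bE.
Qed.

End InitialCoordinates.

(** * Constants, and the Poisson isomorphism *)

Lemma det_bracket_frac_const (K : fieldType) (n k : nat) (u : {fraction det_ring K n k}) c :
  frac_bracket (det_bracket K n k) u (det_const K n k c) = 0.
Proof.
pose br := frac_bracket (det_bracket K n k).
have brMr := frac_bracketMr (@det_bracketMr K n k) (@det_bracketN K n k).
have brN := frac_bracketN (@det_bracketMr K n k) (@det_bracketN K n k).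
(* A derivation that vanishes on the ring; the Leibniz rule for u * b = a then makes it vanish on
   fractions. *)
pose D v := br (det_const K n k c) v.
have DF x : D (FracField.tofrac x) = 0.
  have [p <-] := det_proj_surj x.
  rewrite /D /br (frac_bracket_tofrac (@det_bracketMl K n k) (@det_bracketMr K n k)).
  rewrite -[\pi_ _ _]/(det_proj k c%:MP) det_bracket_proj mat_bracketN.
  by rewrite /mat_bracket mpoly_bracketCr oppr0 rmorph0 tofrac0.
rewrite brN -/br; apply/eqP; rewrite oppr_eq0; apply/eqP; rewrite -/(D u).
have b0 : \d_(repr u) != 0 := denom_ratioP (repr u).
have uE := tofrac_repr u; move: (\n_(repr u)) (\d_(repr u)) b0 uE => a b b0 uE.
have : D (u * FracField.tofrac b) = 0 by rewrite uE divfK ?tofrac_eq0.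
rewrite /D /br brMr -/br -!/(D _) DF mulr0 addr0 => /eqP.
by rewrite mulf_eq0 tofrac_eq0 (negPf b0) orbF => /eqP.
Qed.

Theorem theorem4p6 (K : fieldType) (n k : nat)
    (char_neq2 : 2%N \notin [pchar K])
    (K_big : (exists q : K, q != 0 /\ forall r : nat, (0 < r)%N -> q ^+ r != 1)
             \/ GRing.closed_field_axiom K)
    (k_lt_n : (k < n)%N) :
  exists (m : nat) (mu : 'M[K]_m),
    [/\ (m <= n ^ 2)%N,
        mu^T = - mu
      & poisson_isomorphic
          (det_const K n k) (frac_bracket (det_bracket K n k))
          (rat_const K m) (frac_bracket (log_bracket mu))].
Proof.
have [phi phiE phi_surj] := hook_frac_map K k_lt_n.
pose D (t : 'I_#|@hook n k|) := initial_minor (Xmat K n) (enum_val t).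
have logP s t : exists c : K, mat_bracket (D s) (D t) = c *: (D s * D t).
  exact: initial_minors_log_canonical.
pose mu : 'M[K]_#|@hook n k| := \matrix_(s, t) sval (cid (logP s t)).
have muE s t : mat_bracket (D s) (D t) = mu s t *: (D s * D t).
  by rewrite mxE; case: cid.
(* Nonvanishing makes the coefficients in [mu] unique, so that they inherit the skew-symmetry of the
   bracket. *)
have D0 t : D t != 0.
  apply/eqP => Dt0; have : hook_eval ('X_t : {mpoly K[#|@hook n k|]}) \in det_ideal K n k.
    by rewrite hook_evalX -/(D t) Dt0 det_ideal0.
  by move=> /(hook_eval_det_ideal k_lt_n)/eqP; rewrite -msupp_eq0 msuppX.
have mu_skew : mu^T = - mu.
  apply/matrixP => s t; rewrite [LHS]mxE [RHS]mxE.
  apply/eqP; rewrite -addr_eq0; have := mat_bracketN (D s) (D t).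
  rewrite !muE => /eqP; rewrite -addr_eq0 [D t * D s]mulrC -scalerDl.
  by rewrite scaler_eq0 mulf_eq0 !(negPf (D0 _)) !orbF.
have [psi phiK psiK] := rmorph_bij_inverse phi_surj.
have phi_const c : phi (rat_const K _ c) = det_const K n k c.
  by rewrite phiE hook_evalC.
exists #|@hook n k|, mu; split => //.
  by rewrite (leq_trans (max_card _)) // card_prod card_ord mulnn.
exists psi; split; first by exists phi.
  by move=> c; rewrite -phi_const phiK.
(* The isomorphism [psi] is the inverse of [phi], so compatibility with brackets is transported to
   [phi], where checking the variables suffices. *)
move=> u v; apply: (fmorph_inj phi); rewrite psiK.
rewrite (log_bracket_transfer (br := frac_bracket (det_bracket K n k))) ?psiK //.
- exact: (frac_bracketDr (@det_bracketDr K n k) (@det_bracketMr K n k) (@det_bracketN K n k)).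
- exact: (frac_bracketMr (@det_bracketMr K n k) (@det_bracketN K n k)).
- exact: (frac_bracketN (@det_bracketMr K n k) (@det_bracketN K n k)).
- by move=> a c; rewrite phi_const det_bracket_frac_const.
move=> s t; rewrite !phiE !hook_evalX.
rewrite (frac_bracket_tofrac (@det_bracketMl K n k) (@det_bracketMr K n k)).
rewrite det_bracket_proj muE; congr (FracField.tofrac (det_proj _ _)).
by rewrite -!mul_mpolyC !rmorphM /= hook_evalC !hook_evalX.
Qed.
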